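(* There exists a robot with the following property. For any connected $n$-node graph $G$ (loops and multiple edges allowed) of maximum degree at most an integer $\Delta$ and diameter $D$, and any rational number $\rho\in(2,(D+1)/4]$, it is possible to color the nodes of $G$ with two colors (black and white) such that the $N$-ratio is not less than $\rho$, and, using this labeling, the robot can explore $G$ starting from a node $r$ and terminating at $r$ after identifying that the entire graph has been traversed. The robot has $O(\rho\log\Delta)$ bits of memory, and the total number of edge traversals by the robot is $O\big(n\Delta^{\frac{16\rho+7}{3}}/\rho+\Delta^{\frac{40\rho+10}{3}}\big)$.
   Context: Graph model: $G=(V,E)$ is an undirected connected anonymous graph (no node identifiers), possibly with loops and multiple edges; at each node $v$ the incident edge-ends are numbered by ports $0,\dots,\mathtt{deg}(v)-1$ (arbitrary). A robot is a finite-memory mobile agent with no a priori knowledge of the topology or size of $G$; at a node it sees the degree, the node's color, and the port through which it entered, and it moves by choosing an exit port. For a 1-bit (black/white) labeling of an $n$-node graph with $b$ black nodes, the $N$-ratio is $n/b$. *)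

(* Defs.v *)
From HB Require Import structures.
From Stdlib Require Import Reals QArith Qreals.
From mathcomp Require Import all_boot.

Set Implicit Arguments.
Unset Strict Implicit.
Unset Printing Implicit Defensive.
Local Open Scope nat_scope.

(* Node v has ports 0..deg v - 1.  adj v i = (u, j) means the edge leaving v by port i
   enters u by port j.  adj is an involution on the edge-ends (darts) without fixed
   points, so every edge has exactly two ends; a loop at v uses two distinct ports of v.
   Values of adj outside valid ports are irrelevant. *)
Record pgraph := PGraph {
  node : finType;
  deg : node -> nat;
  adj : node -> nat -> node * nat;
  adj_port : forall v i, i < deg v -> (adj v i).2 < deg (adj v i).1;
  adj_invol : forall v i, i < deg v -> adj (adj v i).1 (adj v i).2 = (v, i);
  adj_nofix : forall v i, i < deg v -> adj v i <> (v, i)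
}.

Definition adjacent (G : pgraph) : rel (node G) :=
  fun u v => [exists i : 'I_(deg u), (adj u i).1 == v].

Definition gconnected (G : pgraph) : Prop :=
  forall u v : node G, exists p : seq (node G), path (@adjacent G) u p /\ last u p = v.

Definition reach_within (G : pgraph) (k : nat) (u v : node G) : Prop :=
  exists p : seq (node G), [/\ path (@adjacent G) u p, last u p = v & size p <= k].

Definition diameter_is (G : pgraph) (D : nat) : Prop :=
  (forall u v : node G, reach_within D u v) /\
  (exists u v : node G, forall k, k < D -> ~ reach_within k u v).

Definition max_deg_le (G : pgraph) (Delta : nat) : Prop :=
  forall v : node G, deg v <= Delta.

Definition nblack (G : pgraph) (col : node G -> bool) : nat := #|[pred v | col v]|.

Definition N_ratio_ge (G : pgraph) (col : node G -> bool) (rho : R) : Prop :=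
  (0 < nblack col)%N /\ Rle rho (Rdiv (INR #|node G|) (INR (nblack col))).

(* At the current node the robot sees: its degree, its colour, and the port by which it
   entered (None at the start).  It outputs a new state and either Some exit port or
   None (= stop). *)
Record robot := Robot {
  rstate : finType;
  rinit : rstate;
  rstep : rstate -> nat -> bool -> option nat -> rstate * option nat
}.

Definition mem_bits (Rb : robot) : R := Rdiv (ln (INR #|rstate Rb|)) (ln 2).

Definition log2 (x : R) : R := Rdiv (ln x) (ln 2).

Definition config (G : pgraph) (Rb : robot) : Type :=
  (node G * rstate Rb * option nat)%type.

Inductive outcome (C : Type) := Halt | Move of C | Err.
Arguments Halt {C}.
Arguments Err {C}.

Definition step (G : pgraph) (Rb : robot) (col : node G -> bool)
    (c : config G Rb) : outcome (config G Rb) :=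
  let '(v, s, e) := c in
  let '(s', a) := rstep s (deg v) (col v) e in
  match a with
  | None => Halt
  | Some p => if p < deg v then Move ((adj v p).1, s', Some (adj v p).2) else Err
  end.

Fixpoint exec (G : pgraph) (Rb : robot) (col : node G -> bool) (k : nat)
    (c : config G Rb) : option (config G Rb) :=
  match k with
  | 0 => Some c
  | k'.+1 => match step col c with Move c' => exec col k' c' | _ => None end
  end.

Definition start_config (G : pgraph) (Rb : robot) (r : node G) : config G Rb :=
  (r, @rinit Rb, None).

Definition explores_in (G : pgraph) (Rb : robot) (col : node G -> bool)
    (r : node G) (T : nat) : Prop :=
  exists cT : config G Rb,
    [/\ exec col T (start_config Rb r) = Some cT,
        step col cT = Halt,
        cT.1.1 = r &
        forall v : node G, exists i c, [/\ (i <= T)%N,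
          exec col i (start_config Rb r) = Some c & c.1.1 = v]].

(* Main.v *)
(* Let d be the distance from an end r of a diameter and P ~ 4 rho.  Below an offset m in
   [P/2, 3P/2) the layers of d are coloured periodically with period P: three black layers,
   a white one, a black one, and P - 5 white ones; r is black too.  The P offsets together
   use at most 4 n black nodes (every layer below P/2 stays white, which pays for the P
   copies of r), so one of them uses at most 4 n / P <= n / rho.
   A node finds its parent in a spanning tree by looking at its neighbourhood.  Only
   the middle of three black layers consists of black nodes without white neighbours; this
   tells the isolated black layer from the triple one, and the thickness of the white zone
   tells the top of a triple layer from its bottom.  White walks do not cross triple
   layers, so the depth of a white node below the closest isolated layer above it (or
   below r) is the least length of a white walk leading to an isolated layer.  All this is
   expressed by modal formulas over the colours, which a robot evaluates by walking, and
   the robot makes an Euler tour of the tree; r is recognised by having no parent.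
   A node at depth j of a white zone costs Delta^(j + O(1)).  This is at most Delta^(P + O(1))
   below depth m, while the top zone, where j may reach m, has at most 2 Delta^m nodes.  The
   Euler tour never repeats a (node, port) pair, being deterministic and halting, so these
   costs are paid once for each pair. *)
Require Import Defs.
From HB Require Import structures.
From Stdlib Require Import Reals QArith Qreals ZArith Lra.
From mathcomp Require Import all_boot zify.
Open Scope R_scope.

Set Implicit Arguments.
Unset Strict Implicit.
Unset Printing Implicit Defensive.

(** * Evaluating modal formulas by walking *)

Section Formulas.
Local Open Scope nat_scope.

(* [Dia false f]: some neighbour satisfies f.  [Dia true f]: the port q given as a
   parameter of [sat] is the first one leading to a neighbour satisfying f. *)
Inductive form := Cst of bool | Blk | If of form & form & form | Dia of bool & form.

Definition Not f := If f (Cst false) (Cst true).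
Definition And f g := If f g (Cst false).

Section Semantics.
Variables (G : pgraph) (col : node G -> bool) (q : nat).

Fixpoint sat (f : form) (v : node G) : bool :=
  match f with
  | Cst b => b
  | Blk => col v
  | If f g h => if sat f v then sat g v else sat h v
  | Dia m f =>
      let i := find (fun i => sat f (adj v i).1) (iota 0 (deg v)) in
      (i < deg v) && (m ==> (i == q))
  end.

Fixpoint eval_time (f : form) (v : node G) : nat :=
  match f with
  | Cst _ | Blk => 0
  | If f g h => eval_time f v + (if sat f v then eval_time g v else eval_time h v)
  | Dia _ f => \sum_(0 <= i < deg v) (eval_time f (adj v i).1 + 2)
  end.

End Semantics.

Section Machine.
Variable N : nat.

(* In the state of [Dia], the first component is the port being probed; [inl None]:
   the probed neighbour has just been entered; [inr (e, s)]: f is being evaluated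
   there and e leads back; [inl (Some b)]: back with the answer b. *)
Fixpoint evst (f : form) : finType :=
  match f with
  | Cst _ | Blk => void
  | If f g h => (evst f + (evst g + evst h))%type
  | Dia _ f => ('I_N.+1 * (option bool + 'I_N.+1 * evst f))%type
  end.

(** [inl (s, p)] requests a move through port [p], keeping state [s]; [inr b] ends the evaluation
    with answer [b], without a move. *)
Definition act (S : Type) : Type := (S * nat + bool)%type.

Definition abind (S S' A : Type) (j : S -> S') (k : bool -> S' * nat + A)
    (a : act S) : S' * nat + A :=
  match a with inl (s, p) => inl (j s, p) | inr b => k b end.

Definition probe m f (dg i : nat) : act (evst (Dia m f)) :=
  if i < dg then inl ((inord i, inl None) : evst (Dia m f), i) else inr false.

Fixpoint begin (f : form) (q dg : nat) (c : bool) : act (evst f) :=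
  match f return act (evst f) with
  | Cst b => inr b
  | Blk => inr c
  | If f g h =>
      abind (S' := evst (If f g h)) inl
        (fun b => if b then abind (S' := evst (If f g h)) (inr \o inl) inr (begin g q dg c)
                  else abind (S' := evst (If f g h)) (inr \o inr) inr (begin h q dg c))
        (begin f q dg c)
  | Dia m f => probe m f dg 0
  end.

Fixpoint cont (f : form) (q : nat) : evst f -> nat -> bool -> nat -> act (evst f) :=
  match f return evst f -> nat -> bool -> nat -> act (evst f) with
  | Cst _ | Blk => fun s _ _ _ => inr true
  | If f g h => fun s dg c en =>
      match s with
      | inl s =>
          abind (S' := evst (If f g h)) inl
            (fun b => if b then abind (S' := evst (If f g h)) (inr \o inl) inr (begin g q dg c)
                      else abind (S' := evst (If f g h)) (inr \o inr) inr (begin h q dg c))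
            (cont q s dg c en)
      | inr (inl s) => abind (S' := evst (If f g h)) (inr \o inl) inr (cont q s dg c en)
      | inr (inr s) => abind (S' := evst (If f g h)) (inr \o inr) inr (cont q s dg c en)
      end
  | Dia m f => fun s dg c en =>
      let i := s.1 in
      match s.2 with
      | inl None =>
          abind (S' := evst (Dia m f)) (fun s => (i, inr (inord en, s)))
            (fun b => inl ((i, inl (Some b)) : evst (Dia m f), en)) (begin f q dg c)
      | inl (Some b) =>
          if b then inr (m ==> (nat_of_ord i == q)) else probe m f dg i.+1
      | inr (e, s) =>
          abind (S' := evst (Dia m f)) (fun s => (i, inr (e, s)))
            (fun b => inl ((i, inl (Some b)) : evst (Dia m f), nat_of_ord e))
            (cont q s dg c en)
      end
  end.

Section Runs.
Variables (G : pgraph) (col : node G -> bool).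

Inductive runs (S : Type) (ct : S -> nat -> bool -> nat -> act S) :
    node G -> act S -> nat -> node G -> bool -> Prop :=
  | runs_done v b : runs ct v (inr b) 0 v b
  | runs_move v s p n w b : p < deg v ->
      runs ct (adj v p).1 (ct s (deg (adj v p).1) (col (adj v p).1) (adj v p).2) n w b ->
      runs ct v (inl (s, p)) n.+1 w b.

Lemma runs_bind (S S' : Type) ct ct' (j : S -> S') (k : nat -> bool -> bool -> act S')
    v a n w b n' w' b' :
  (forall s dg c en, ct' (j s) dg c en = abind j (k dg c) (ct s dg c en)) ->
  runs ct v a n w b ->
  runs ct' w (k (deg w) (col w) b) n' w' b' ->
  runs ct' v (abind j (k (deg v) (col v)) a) (n + n') w' b'.
Proof.
move=> Hj; elim=> {v a n w b} [v b //|v s p n w b pv _ IH H].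
by rewrite addSn /=; apply: runs_move => //; rewrite Hj; apply: IH.
Qed.

Lemma runs_map (S S' : Type) ct ct' (j : S -> S') v a n w b :
  (forall s dg c en, ct' (j s) dg c en = abind j inr (ct s dg c en)) ->
  runs ct v a n w b -> runs ct' v (abind j inr a) n w b.
Proof.
move=> Hj H; rewrite -[n]addn0.
by apply: (runs_bind (k := fun _ _ => inr)) Hj H _; apply: runs_done.
Qed.

Hypothesis degN : forall v : node G, deg v <= N.

Lemma find_iotaP (a : pred nat) n i : i < n -> (forall j, j < i -> ~~ a j) ->
  a i -> find a (iota 0 n) = i.
Proof.
move=> i_n Hj ai; have h : has a (iota 0 n).
  by apply/hasP; exists i => //; rewrite mem_iota.
have f_n : find a (iota 0 n) < n by rewrite -[X in _ < X](size_iota 0) -has_find.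
case: (ltngtP (find a (iota 0 n)) i) => // [lt|lt].
  by move: (nth_find 0 h); rewrite nth_iota // add0n (negbTE (Hj _ lt)).
by move: (before_find 0 lt); rewrite nth_iota // add0n ai.
Qed.

(** Evaluation ends where it began: a probe ends at the neighbour it entered, by induction, and the
    stored entry port leads back. Hence two extra moves per port. *)
Lemma eval_runs q f v : exists2 n, n <= eval_time col q f v &
  runs (@cont f q) v (begin f q (deg v) (col v)) n v (sat col q f v).
Proof.
elim: f v => [b||f IHf g IHg h IHh|m f IHf] v.
- by exists 0 => //; apply: runs_done.
- by exists 0 => //; apply: runs_done.
- have [n1 l1 r1] := IHf v.
  suff [n2 l2 r2] : exists2 n2, n2 <= (if sat col q f v then eval_time col q g v
                                       else eval_time col q h v) &
    runs (@cont (If f g h) q) v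
      (if sat col q f v
       then abind (S' := evst (If f g h)) (inr \o inl) inr (begin g q (deg v) (col v))
       else abind (S' := evst (If f g h)) (inr \o inr) inr (begin h q (deg v) (col v)))
      n2 v (sat col q (If f g h) v).
    exists (n1 + n2); first by rewrite leq_add.
    by apply: (runs_bind (k := fun dg c b => if b
        then abind (S' := evst (If f g h)) (inr \o inl) inr (begin g q dg c)
        else abind (S' := evst (If f g h)) (inr \o inr) inr (begin h q dg c))) r1 r2.
  rewrite /=; case: (sat col q f v).
  + by have [n2 l2 r2] := IHg v; exists n2 => //; apply: runs_map r2.
  + by have [n2 l2 r2] := IHh v; exists n2 => //; apply: runs_map r2.
- pose F i := eval_time col q f (adj v i).1 + 2.
  (* [k] counts the ports still to be probed; the failures before [i] make [i] the first success. *)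
  suff H k i : i + k = deg v -> (forall j, j < i -> ~~ sat col q f (adj v j).1) ->
      exists2 n, n <= \sum_(i <= j < deg v) F j &
      runs (@cont (Dia m f) q) v (probe m f (deg v) i) n v (sat col q (Dia m f) v).
    by apply: (H (deg v)).
  elim: k i => [|k IHk] i ik Hi.
    exists 0 => //; rewrite /probe -ik addn0 ltnn /=.
    suff -> : find (fun j => sat col q f (adj v j).1) (iota 0 (deg v)) = deg v.
      by rewrite ltnn; apply: runs_done.
    rewrite hasNfind ?size_iota //; apply/hasPn => j; rewrite mem_iota => /= jv.
    by apply: Hi; rewrite -[i]addn0 ik.
  have iv : i < deg v by rewrite -ik addnS ltnS leq_addr.
  have iN : i < N.+1 by rewrite ltnS (leq_trans (ltnW iv)).
  have := adj_port iv; have := adj_invol iv; rewrite big_ltn // {1}/F.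
  case E: (adj v i) => [x e] /= xe ex.
  have eN : e < N.+1 by rewrite ltnS (leq_trans (ltnW ex)).
  have [n1 l1 r1] := IHf x.
  have Erun n : runs (@cont (Dia m f) q) v
       (@cont (Dia m f) q (inord i, inl (Some (sat col q f x))) (deg v) (col v) i) n v
       (sat col q (Dia m f) v) ->
    runs (@cont (Dia m f) q) v (probe m f (deg v) i) (n1 + n.+1).+1 v
       (sat col q (Dia m f) v).
    move=> r2; rewrite /probe iv; apply: runs_move => //; rewrite E.
    apply: (runs_bind (k := fun dg c b => inl ((inord i, inl (Some b)) : evst (Dia m f), e)))
      r1 _.
      by move=> s dg c en /=; rewrite !inordK.
    by apply: runs_move => //; rewrite xe.
  case fx: (sat col q f x) in Erun *.
    exists (n1 + 1).+1.
      by rewrite addn1 -addn2 -addnA; apply: leq_add.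
    apply: Erun; rewrite /= inordK //.
    rewrite (@find_iotaP _ _ i) ?E // iv /=; exact: runs_done.
  have [|j|n2 l2 r2] := IHk i.+1; first by rewrite addSn -addnS.
    by rewrite ltnS leq_eqVlt => /predU1P [->|/Hi //]; rewrite E /= fx.
  exists (n1 + n2.+1).+1.
    rewrite addnS -addn2 -addnA [n2 + 2]addnC addnA; apply: leq_add => //.
    by rewrite leq_add2r.
  by apply: Erun; rewrite /= inordK.
Qed.

End Runs.
End Machine.
End Formulas.

(** * Euler tour of a tree given by parent ports *)

Section Tour.
Local Open Scope nat_scope.

Section Robot.
Variables (N : nat) (ipp rootf : form).

Definition tstate : finType :=
  (option (option bool) + (bool * 'I_N.+1 * evst N ipp + evst N rootf))%type.

(* At port p of v with adj v p = (x, q): go to x ([Out]); if q is the parent port of x,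
   continue with port q + 1 of x; otherwise return to v ([Back]); if p is the parent port
   of v, go to x again ([Cross]) and continue with q + 1; otherwise continue with p + 1. *)
Definition Init : tstate := inl None.
Definition Out : tstate := inl (Some None).
Definition Back : tstate := inl (Some (Some true)).
Definition Cross : tstate := inl (Some (Some false)).
Definition Check (b : bool) (q : nat) (s : evst N ipp) : tstate := inr (inl (b, inord q, s)).
Definition Root (s : evst N rootf) : tstate := inr (inr s).

Definition pending : Type := (tstate * nat + unit)%type.

Definition after_root (b : bool) : pending := if b then inr tt else inl (Out, 0).

Definition proc (dg : nat) (c : bool) (p : nat) : pending :=
  if p < dg then inl (Out, p)
  else abind Root after_root (begin N rootf 0 dg c).

(** [b] tells which end of the edge was tested: [true] for the far end, after [Out], and [false] for
    the near end, after [Back]. *)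
Definition after_check (b : bool) (q dg : nat) (c ans : bool) : pending :=
  if b then (if ans then proc dg c q.+1 else inl (Back, q))
  else (if ans then inl (Cross, q) else proc dg c q.+1).

Definition tstep (s : tstate) (dg : nat) (c : bool) (en : option nat) : pending :=
  let q := odflt 0 en in
  match s with
  | inl None => proc dg c 0
  | inl (Some None) => abind (Check true q) (after_check true q dg c) (begin N ipp q dg c)
  | inl (Some (Some true)) =>
      abind (Check false q) (after_check false q dg c) (begin N ipp q dg c)
  | inl (Some (Some false)) => proc dg c q.+1
  | inr (inl (b, p, s)) =>
      abind (Check b p) (after_check b p dg c) (cont p s dg c q)
  | inr (inr s) => abind Root after_root (cont 0 s dg c q)
  end.

Definition tour_robot : robot :=
  @Robot tstate Init (fun s dg c en =>
    match tstep s dg c en with inl (s', p) => (s', Some p) | inr _ => (Init, None) end).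

Section Run.
Variables (G : pgraph) (col : node G -> bool).
Hypothesis degN : forall v : node G, deg v <= N.

Inductive prun : node G -> pending -> nat -> node G -> pending -> Prop :=
  | prun_refl v a : prun v a 0 v a
  | prun_step v s p n w a : p < deg v ->
      prun (adj v p).1
        (tstep s (deg (adj v p).1) (col (adj v p).1) (Some (adj v p).2)) n w a ->
      prun v (inl (s, p)) n.+1 w a.

Lemma prun_trans v a n w b n' u c :
  prun v a n w b -> prun w b n' u c -> prun v a (n + n') u c.
Proof. by elim=> // {}v s p {}n {}w {}b pv _ IH /IH; apply: prun_step. Qed.

Lemma prun_bind (S : Type) ct (j : S -> tstate) (k : nat -> bool -> bool -> pending)
    v a n w b :
  (forall s dg c en, tstep (j s) dg c (Some en) = abind j (k dg c) (ct s dg c en)) ->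
  runs col ct v a n w b ->
  prun v (abind j (k (deg v) (col v)) a) n w (k (deg w) (col w) b).
Proof.
move=> Hj; elim=> {v a n w b} [v b|v s p n w b pv _ IH] /=; first exact: prun_refl.
by apply: prun_step => //; rewrite Hj.
Qed.

Definition at_port (x : node G * nat) : pending := proc (deg x.1) (col x.1) x.2.

Definition isparent (v : node G) (p : nat) := sat col p ipp v.
Definition isroot (v : node G) := sat col 0 rootf v.

(** The tour with evaluations collapsed. [deg v] is a fictitious port after the last one, where the
    root test takes place. *)
Definition next_port (x : node G * nat) : option (node G * nat) :=
  let: (v, p) := x in
  if p < deg v then
    let: (u, q) := adj v p in
    if isparent u q || isparent v p then Some (u, q.+1) else Some (v, p.+1)
  else if isroot v then None else Some (v, 0).

(** The 3 moves are [Out], [Back] and [Cross]; [ipp] may be evaluated at both ends of the edge. *)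
Definition port_cost (x : node G * nat) : nat :=
  let: (v, p) := x in
  if p < deg v then
    3 + eval_time col (adj v p).2 ipp (adj v p).1 + eval_time col p ipp v
  else eval_time col 0 rootf v.

Lemma check_run b v q : q < deg v -> exists2 n, n <= eval_time col q ipp v &
  prun v (abind (Check b q) (after_check b q (deg v) (col v)) (begin N ipp q (deg v) (col v)))
    n v (after_check b q (deg v) (col v) (isparent v q)).
Proof.
move=> qv; have [n ln rn] := eval_runs col degN q ipp v.
exists n => //; apply: (prun_bind (k := fun dg c => after_check b q dg c)) rn.
move=> s dg c en; rewrite /= !inordK // ltnS; exact: leq_trans (ltnW qv) _.
Qed.

Lemma root_run v : exists2 n, n <= eval_time col 0 rootf v &
  prun v (abind Root after_root (begin N rootf 0 (deg v) (col v)))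
    n v (after_root (isroot v)).
Proof.
have [n ln rn] := eval_runs col degN 0 rootf v.
by exists n => //; apply: (prun_bind (k := fun _ _ => after_root)) rn.
Qed.

Lemma next_port_run x y : 0 < deg x.1 -> next_port x = Some y ->
  exists2 n, n <= port_cost x & prun x.1 (at_port x) n y.1 (at_port y).
Proof.
case: x => v p /= dv; rewrite /at_port {1}/proc /=; case: ifP => pv; last first.
  case: ifP => // rv [<-] /=.
  have [n ln] := root_run v; rewrite rv => rn; exists n => //.
  by rewrite /proc dv.
have := adj_port pv; have := adj_invol pv; case E: (adj v p) => [u q] /= uq qu.
have [n1 l1 r1] := check_run true qu.
have [n2 l2 r2] := check_run false pv.
have go n w a : prun u (after_check true q (deg u) (col u) (isparent u q)) n w a ->
    prun v (inl (Out, p)) (n1 + n).+1 w a.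
  by move=> H; apply: prun_step => //; rewrite E /=; apply: prun_trans r1 H.
case uP: (isparent u q) go => /= go.
  move=> [<-]; exists (n1 + 0).+1; first by lia.
  by apply: go; apply: prun_refl.
have back n w a : prun v (after_check false p (deg v) (col v) (isparent v p)) n w a ->
    prun v (inl (Out, p)) (n1 + (n2 + n).+1).+1 w a.
  by move=> H; apply/go/prun_step => //; rewrite uq /=; apply: prun_trans r2 H.
case vP: (isparent v p) back => /= back [<-].
  exists (n1 + (n2 + 1).+1).+1; first by lia.
  by apply/back/prun_step => //; rewrite E; apply: prun_refl.
exists (n1 + (n2 + 0).+1).+1; first by lia.
by apply: back; apply: prun_refl.
Qed.

Definition config_pending (c : config G tour_robot) : pending :=
  tstep c.1.2 (deg c.1.1) (col c.1.1) c.2.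

Lemma prun_exec v a n w b (c : config G tour_robot) :
  prun v a n w b -> c.1.1 = v -> config_pending c = a ->
  exists c', [/\ exec col n c = Some c', c'.1.1 = w & config_pending c' = b].
Proof.
move=> H; elim: H c => {v a n w b} [v a|v s p n w a pv _ IH] [[v' t] e] /= -> Hc.
  by exists (v, t, e).
by rewrite /config_pending /= in Hc; rewrite Hc pv; apply: IH.
Qed.

Lemma exec_add n m (c c' : config G tour_robot) :
  exec col n c = Some c' -> exec col (n + m) c = exec col m c'.
Proof.
elim: n c => [c [->] //|n IH c] /=.
by case: (step col c) => // d /IH.
Qed.

Inductive ports_run : node G * nat -> seq (node G * nat) -> node G * nat -> Prop :=
  | ports_nil x : ports_run x [::] x
  | ports_cons x y l z :
      next_port x = Some y -> ports_run y l z -> ports_run x (x :: l) z.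

Lemma ports_run_cat x l y l' z :
  ports_run x l y -> ports_run y l' z -> ports_run x (l ++ l') z.
Proof. by elim=> // {}x y' {}l {}z' xy _ IH /IH; apply: ports_cons. Qed.

Lemma ports_run_inv x l z : ports_run x l z ->
  if l is a :: l' then a = x /\ exists2 y, next_port x = Some y & ports_run y l' z
  else x = z.
Proof. by case=> // {}x y {}l {}z xy yz; split=> //; exists y. Qed.

Lemma ports_run_det x l y l' : next_port y = None ->
  ports_run x l y -> ports_run x l' y -> l = l'.
Proof.
move=> yN H; elim: H l' yN => {x l y} [x|x y l z xy _ IH] [|a l'] zN /ports_run_inv //.
- by case=> _ [y]; rewrite zN.
- by move=> E; rewrite E zN in xy.
- case=> -> [y']; rewrite xy => -[<-] H; congr (_ :: _); exact: IH.
Qed.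

Lemma ports_run_le x l z : ports_run x l z -> x.2 <= deg x.1 ->
  forall y, y \in l -> y.2 <= deg y.1.
Proof.
elim=> // {l z} {}x y l z xy _ IH xle t; rewrite inE => /predU1P [-> //|]; apply: IH.
move: xy; case: x {xle} => v p /=; case: ifP => pv; last by case: ifP => // _ [<-].
by have := adj_port pv; case: (adj v p) => u q /= qu; case: ifP => _ [<-].
Qed.

(** A second visit to [x] would start a strictly shorter run to the same halting pair, against
    determinism. *)
Lemma ports_run_uniq x l y : next_port y = None -> ports_run x l y -> uniq l.
Proof.
move=> yN H; elim: H yN => {x l y} [//|x y l z xy H IH] zN /=.
rewrite IH // andbT; apply/negP => xl.
have [l2 [l2l H2]] : exists l2, size l2 <= size l /\ ports_run x l2 z.
  elim: H xl {IH xy zN} => [//|a b l' c ab H IH].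
  rewrite inE => /predU1P [->|/IH [l2 [s2 r2]]].
    by exists (a :: l'); split=> //; apply: ports_cons H.
  by exists l2; split=> //; apply: leq_trans s2 _.
have /(congr1 size) := ports_run_det zN H2 (ports_cons xy H).
by move=> /= E; rewrite E ltnn in l2l.
Qed.

Hypothesis deg_gt0 : forall v : node G, 0 < deg v.

Lemma ports_run_exec x l y (c : config G tour_robot) :
  ports_run x l y -> c.1.1 = x.1 -> config_pending c = at_port x ->
  exists n c', [/\ n <= \sum_(z <- l) port_cost z,
    exec col n c = Some c', c'.1.1 = y.1, config_pending c' = at_port y &
    forall z, z \in l -> exists i c'', [/\ i <= n, exec col i c = Some c'' & c''.1.1 = z.1]].
Proof.
move=> H; elim: H c => {x l y} [x|x y l z xy _ IH] c cx ca.
  by exists 0, c; split=> //; rewrite big_nil.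
have [n1 l1 r1] := next_port_run (deg_gt0 _) xy.
have [c1 [e1 x1 p1]] := prun_exec r1 cx ca.
have [n2 [c2 [l2 e2 x2 p2 vis]]] := IH _ x1 p1.
exists (n1 + n2), c2; split => //; first by rewrite big_cons leq_add.
  by rewrite (exec_add _ e1).
move=> t; rewrite inE => /predU1P [->|/vis [i [d [li ei di]]]]; first by exists 0, c.
by exists (n1 + i), d; split; rewrite ?leq_add2l // (exec_add _ e1).
Qed.

Variables (r : node G) (mu : node G -> nat).
Hypothesis root_only : forall v, isroot v = (v == r).
Hypothesis par_port : forall v p, isparent v p -> p < deg v.
Hypothesis par_uniq : forall v p p', isparent v p -> isparent v p' -> p = p'.
Hypothesis par_root : forall p, ~~ isparent r p.
Hypothesis par_ex : forall v, v != r -> exists p, isparent v p.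
Hypothesis par_mu : forall v p, isparent v p -> mu (adj v p).1 < mu v.

Inductive descends (v : node G) : node G -> Prop :=
  | desc_refl : descends v v
  | desc_step w p : isparent w p -> descends v (adj w p).1 -> descends v w.

Lemma descends_child v w : descends v w -> w = v \/
  exists x p, [/\ isparent x p, (adj x p).1 = v & descends x w].
Proof.
elim=> [|{}w p wp _ [E|[x [p' [xp xv xw]]]]]; first by left.
  by right; exists w, p; split=> //; apply: desc_refl.
by right; exists x, p'; split=> //; apply: desc_step wp xw.
Qed.

Lemma descends_root w : descends r w.
Proof.
have [n] := ubnP (mu w); elim: n w => // n IH w lw.
have [->|/par_ex [p wp]] := eqVneq w r; first exact: desc_refl.
by apply: (desc_step wp); apply: IH; apply: leq_trans (par_mu wp) _; rewrite -ltnS.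
Qed.

(** Entered through the parent edge, the tour comes back to the parent at the port following that
    edge. *)
Definition subtree_tour v := forall q, isparent v q ->
  exists2 l, ports_run (v, q.+1) l ((adj v q).1, (adj v q).2.+1) &
    forall w, descends v w -> w \in [seq z.1 | z <- l].

(** Ports other than the parent port are passed in order: an edge to a child inserts the tour of its
    subtree, any other edge is skipped. *)
Lemma sweep v i k : (forall x, mu v < mu x -> subtree_tour x) ->
  i + k <= deg v -> (forall p, i <= p < i + k -> ~~ isparent v p) ->
  exists2 l, ports_run (v, i) l (v, i + k) &
    forall x p q w, isparent x p -> adj x p = (v, q) -> i <= q < i + k ->
    descends x w -> w \in [seq z.1 | z <- l].
Proof.
move=> IH; elim: k i => [|k IHk] i ik Hi.
  exists [::]; rewrite addn0; first exact: ports_nil.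
  by move=> x p q w _ _ /andP [/leq_ltn_trans h /h]; rewrite ltnn.
have iv : i < deg v by lia.
have [|p pi|l rl vl] := IHk i.+1; first by lia.
  by apply: Hi; lia.
rewrite addSnnS in rl vl.
have := adj_port iv; have := adj_invol iv.
case E: (adj v i) => [u q] /= uq qu; have iP : ~~ isparent v i by apply: Hi; lia.
have next : next_port (v, i) = if isparent u q then Some (u, q.+1) else Some (v, i.+1).
  by rewrite /= iv E (negbTE iP) orbF.
case uP: (isparent u q) next => next; last first.
  exists ((v, i) :: l); first exact: ports_cons rl.
  move=> x p t w xp xv; rewrite leq_eqVlt => /andP [/predU1P [it|it] tk] xw.
    move: (adj_invol (par_port xp)); rewrite xv /= -it E => -[ux qp].
    by rewrite ux qp xp in uP.
  by rewrite /= inE (vl _ _ _ _ xp xv) ?orbT // it.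
have [] := IH u _ q uP; first by have := par_mu uP; rewrite uq.
rewrite uq /= => l1 r1 v1.
exists ((v, i) :: l1 ++ l).
  by apply: ports_cons next _; apply: ports_run_cat r1 rl.
move=> x p t w xp xv; rewrite leq_eqVlt => /andP [/predU1P [it|it] tk] xw.
  move: (adj_invol (par_port xp)); rewrite xv /= -it E => -[ux _].
  by rewrite -ux in xw; rewrite /= inE map_cat mem_cat v1 // orbT.
by rewrite /= inE map_cat mem_cat (vl _ _ _ _ xp xv) ?orbT // it.
Qed.

(** An edge is not the parent edge of both its ends, as [mu] would decrease both ways. *)
Lemma child_port v w : descends v w -> w = v \/
  exists x p q, [/\ isparent x p, adj x p = (v, q), q < deg v, ~~ isparent v q
    & descends x w].
Proof.
move=> /descends_child [|[x [p [xp xv xw]]]]; first by left.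
right; exists x, p, (adj x p).2.
have := adj_port (par_port xp); have := adj_invol (par_port xp); have := par_mu xp.
move: xv; case: (adj x p) => u q /= -> vx E qv; split=> //.
by apply/negP => /par_mu; rewrite E /= ltnNge ltnW.
Qed.

Lemma subtree_tourP v : subtree_tour v.
Proof.
have [B HB] : exists B, forall v, mu v <= B.
  by exists (\max_v mu v) => u; apply: leq_bigmax.
have [n] := ubnP (B - mu v); elim: n v => // n IHn v lt q vq.
have IH x : mu v < mu x -> subtree_tour x.
  by move=> vx; apply: IHn; have := HB x; lia.
have qv := par_port vq; have notq p : p != q -> ~~ isparent v p.
  by apply: contra => /par_uniq /(_ vq) ->.
have nonroot : isroot v = false.
  by rewrite root_only; apply/negP => /eqP E; have := par_root q; rewrite -E vq.
have [||l1 r1 v1] := @sweep v q.+1 (deg v - q.+1) IH; first by lia.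
  by move=> p pq; apply: notq; lia.
have [||l2 r2 v2] := @sweep v 0 q IH; first by rewrite add0n ltnW.
  by move=> p pq; apply: notq; lia.
rewrite subnKC // in r1 v1; rewrite add0n in r2 v2.
have q_out : next_port (v, q) = Some ((adj v q).1, (adj v q).2.+1).
  by rewrite /= qv; case: (adj v q) => u t /=; rewrite vq orbT.
have wrap : next_port (v, deg v) = Some (v, 0) by rewrite /= ltnn nonroot.
(* The ports after [q], the wrap-around at the fictitious port, the ports before [q], and the exit
   through [q]. *)
exists (l1 ++ (v, deg v) :: l2 ++ [:: (v, q)]).
  apply: ports_run_cat r1 _; apply: ports_cons wrap _; apply: ports_run_cat r2 _.
  by apply: ports_cons q_out _; apply: ports_nil.
move=> w /child_port [->|[x [p [t [xp xv tv vt xw]]]]].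
  by rewrite map_cat mem_cat /= inE eqxx orbT.
have : t != q by apply: contraNneq vt => ->.
rewrite neq_ltn map_cat mem_cat /= inE map_cat mem_cat; case/orP => tq.
  by rewrite (v2 _ _ _ _ xp xv) // !orbT.
by rewrite (v1 _ _ _ _ xp xv) // tq.
Qed.

Lemma root_tour : exists2 l, ports_run (r, 0) l (r, deg r) &
  forall w, w \in [seq z.1 | z <- (r, deg r) :: l].
Proof.
have [|||l rl vl] := @sweep r 0 (deg r) => //; first by move=> x _; apply: subtree_tourP.
exists l => // w; rewrite inE.
case: (child_port (descends_root w)) => [->|[x [p [t [xp xv tv vt xw]]]]].
  by rewrite eqxx.
by rewrite (vl _ _ _ _ xp xv) ?orbT.
Qed.

(** No pair is repeated, so each is charged once; [N.+1] values of [p] make room for the fictitious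
    port [deg v]. *)
Lemma tour_explores : exists2 T, explores_in tour_robot col r T &
  T <= \sum_(v : node G) \sum_(p < N.+1) port_cost (v, nat_of_ord p).
Proof.
have [l rl vl] := root_tour.
have rend : next_port (r, deg r) = None by rewrite /= ltnn root_only eqxx.
have lu := ports_run_uniq rend rl.
have [n [c [ln en cr cp vis]]] :=
  ports_run_exec rl (erefl : (start_config tour_robot r).1.1 = r) erefl.
(* The last root test belongs to the halting pair, which is not in [l]. *)
have [m lm rm] := root_run r; rewrite root_only eqxx /= in rm.
have [c' [e' r' p']] : exists c', [/\ exec col m c = Some c', c'.1.1 = r &
    config_pending c' = inr tt].
  by apply: prun_exec cr _; [exact: rm | rewrite cp /at_port /proc /= ltnn].
exists (n + m).
  exists c'; split=> //; first by rewrite (exec_add _ en).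
    by move: p'; case: (c') => [[v s] e]; rewrite /config_pending /= => ->.
  move=> v; have := vl v; rewrite /= inE => /predU1P [->|/mapP [z zl ->]].
    by exists 0, (start_config tour_robot r).
  by have [i [d [li ei di]]] := vis z zl; exists i, d; split=> //; lia.
have -> : \sum_(v : node G) \sum_(p < N.+1) port_cost (v, nat_of_ord p) =
    \sum_(z <- [seq (x.1, nat_of_ord x.2) | x : node G * 'I_N.+1]) port_cost z.
  by rewrite pair_bigA /= big_image /=; apply: eq_bigr => -[].
apply: (@leq_trans (\sum_(z <- rcons l (r, deg r)) port_cost z)).
  by rewrite -cats1 big_cat big_seq1 /= ltnn leq_add.
apply: uniq_sub_le_big => //.
- by move=> x y; apply: leq_addr.
- rewrite rcons_uniq lu andbT; apply/negP => rl'.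
  have : next_port (r, deg r) by elim: rl rl' {vl lu vis ln rend cp} =>
    // x y l' z xy _ IH; rewrite inE => /predU1P [->|/IH //]; rewrite xy.
  by rewrite rend.
- by rewrite map_inj_uniq ?enum_uniq // => -[v p] [u q] /= [-> /val_inj ->].
- move=> [v p]; rewrite mem_rcons inE => /orP H.
  suff pv : p <= deg v.
    have pN : p < N.+1 by rewrite ltnS; apply: leq_trans pv _.
    by apply/imageP; exists (v, Ordinal pN).
  by case: H => [/eqP [-> ->] //|/(ports_run_le rl (leq0n _))].
Qed.

End Run.
End Robot.
End Tour.

(** * Recognising the layers *)

Section Decoding.
Local Open Scope nat_scope.

Definition no_white_nbr := Not (Dia false (Not Blk)).
Definition isB := And Blk (And (Dia false (Not Blk)) (Not (Dia false (And Blk no_white_nbr)))).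
Definition isTriple := And Blk (Not isB).
Definition isTop :=
  And isTriple (Dia false (And (Not Blk) (Dia false (And (Not Blk) (Not (Dia false Blk)))))).
Definition isMid := And (And isTriple (Not isTop)) (Dia false isTop).
Definition isOff := And (Not Blk) (Dia false (And isTriple (Not isTop))).

Fixpoint level (j : nat) : form :=
  if j is j'.+1 then And (Not Blk) (Dia false (level j')) else isB.

(** A search for the least level, cut off after [k] values because the robot is fixed before the
    graph. *)
Fixpoint find_level (k j : nat) : form :=
  if k is k'.+1 then If (level j) (Dia true (level j.-1)) (find_level k' j.+1)
  else Cst false.

(** Black nodes failing the first three tests form the bottom of a triple layer; white nodes failing
    [isOff] are located by their level. *)
Definition isParent (J : nat) : form :=
  If isB (Dia true isOff)
 (If isTop (Dia true (Not Blk))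
 (If isMid (Dia true isTop)
 (If Blk (Dia true isMid)
 (If isOff (Dia true isTriple)
  (find_level J 1))))).

Definition isRoot : form := And isB (Not (Dia false isOff)).

(** Such formulas do not read the parameter [q], so the first port leading to a node that satisfies
    them is well defined. *)
Fixpoint port_free (f : form) : bool :=
  match f with
  | Cst _ | Blk => true
  | If f g h => [&& port_free f, port_free g & port_free h]
  | Dia m f => ~~ m && port_free f
  end.

Lemma port_free_level j : port_free (level j).
Proof. by elim: j => //= j ->. Qed.

Section Sat.
Variables (G : pgraph) (col : node G -> bool).

Lemma sat_port_free q q' f v : port_free f -> sat col q f v = sat col q' f v.
Proof.
elim: f v => [//|//|f IHf g IHg h IHh|m f IHf] v /=.
  by move=> /and3P [pf pg ph]; rewrite IHf // IHg // IHh.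
case: m => //= pf; rewrite (@eq_find _ _ (fun i => sat col q' f (adj v i).1)) // => i.
exact: IHf.
Qed.

Lemma adjacentP (u v : node G) :
  reflect (exists2 i, i < deg u & (adj u i).1 = v) (adjacent u v).
Proof.
apply: (iffP existsP) => [[i /eqP E]|[i iu E]]; first by exists i.
by exists (Ordinal iu); apply/eqP.
Qed.

Lemma adjacent_sym (u v : node G) : adjacent u v = adjacent v u.
Proof.
wlog suff: u v / adjacent u v -> adjacent v u by move=> H; apply/idP/idP; apply: H.
move=> /adjacentP [i iu <-]; apply/adjacentP; exists (adj u i).2; first exact: adj_port.
by rewrite adj_invol.
Qed.

Lemma sat_If q f g h v : sat col q (If f g h) v =
  if sat col q f v then sat col q g v else sat col q h v.
Proof. by []. Qed.

Lemma sat_And q f g v : sat col q (And f g) v = sat col q f v && sat col q g v.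
Proof. by rewrite /=; case: ifP. Qed.

Lemma sat_Not q f v : sat col q (Not f) v = ~~ sat col q f v.
Proof. by rewrite /=; case: ifP. Qed.

Lemma sat_Blk q v : sat col q Blk v = col v.
Proof. by []. Qed.

Lemma sat_DiaP q f v :
  reflect (exists2 u, adjacent v u & sat col q f u) (sat col q (Dia false f) v).
Proof.
rewrite /= andbT -{2}(size_iota 0 (deg v)) -has_find.
apply: (iffP hasP) => [[i]|[u /adjacentP [i iv <-] fu]].
  by rewrite mem_iota => /= iv fi; exists (adj v i).1 => //; apply/adjacentP; exists i.
by exists i => //; rewrite mem_iota.
Qed.

Lemma sat_firstP q f v : sat col q (Dia true f) v ->
  q < deg v /\ sat col q f (adj v q).1.
Proof.
rewrite /=; set a := fun i => _; set i := find a _ => /andP [iv /eqP iq].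
rewrite -iq; split=> //.
have h : has a (iota 0 (deg v)) by rewrite has_find size_iota.
by have := nth_find 0 h; rewrite -/i nth_iota // iq.
Qed.

Lemma sat_first_uniq p q f v : port_free f ->
  sat col p (Dia true f) v -> sat col q (Dia true f) v -> p = q.
Proof.
move=> pf /= /andP [_ /eqP <-] /andP [_ /eqP <-].
by apply: eq_find => i; apply: sat_port_free.
Qed.

Lemma sat_first_ex f v u : port_free f -> adjacent v u -> sat col 0 f u ->
  exists q, sat col q (Dia true f) v.
Proof.
move=> pf vu fu.
have := introT (sat_DiaP 0 f v) (ex_intro2 _ _ u vu fu).
rewrite /= andbT => H; exists (find (fun i => sat col 0 f (adj v i).1) (iota 0 (deg v))).
have E q : find (fun i => sat col q f (adj v i).1) (iota 0 (deg v)) =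
           find (fun i => sat col 0 f (adj v i).1) (iota 0 (deg v)).
  by apply: eq_find => i; apply: sat_port_free.
by rewrite /= !E H eqxx.
Qed.

End Sat.
Local Arguments sat : simpl never.

(** * Meaning of the formulas in a coloured layering *)

Section Layers.
Variables (G : pgraph) (r : node G) (d : node G -> nat).
Hypothesis d_root : forall v, (d v == 0) = (v == r).
Hypothesis d_adj : forall u v, adjacent u v -> d v <= (d u).+1.
Hypothesis d_par : forall v, v != r -> exists2 u, adjacent v u & d v = (d u).+1.
Hypothesis root_child : exists2 u, adjacent r u & d u = 1.
(* [code] of a layer: 0, 1, 2 are the three layers of a black run (in layer 0 only the
   nodes with a child are black), 3 is white, 4 is black, and code 4 + j is at distance
   j below the last layer of code 4. *)
Variable code : nat -> nat.
Hypothesis code0 : code 0 = 4.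
Hypothesis codeS : forall k, code k.+1 = (code k).+1 \/ (code k.+1 = 0 /\ 7 <= code k).

Definition has_child (v : node G) := [exists u, adjacent v u && (d u == (d v).+1)].

(** A black node of code 0 without child would see a white parent and no node of the middle layer,
    and would satisfy [isB]; it is therefore left white. *)
Definition layer_color (v : node G) : bool :=
  let k := code (d v) in [|| k == 1, k == 2, k == 4 | (k == 0) && has_child v].

Notation cd v := (code (d v)).
Notation col := layer_color.

Lemma nbr_codes u v : adjacent u v ->
  [\/ d v = d u /\ cd v = cd u, d v = (d u).+1 /\ (cd v = (cd u).+1 \/ (cd v = 0 /\ 7 <= cd u)) |
      d u = (d v).+1 /\ (cd u = (cd v).+1 \/ (cd u = 0 /\ 7 <= cd v))].
Proof.
move=> uv; have vu := uv; rewrite adjacent_sym in vu.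
have h1 := d_adj uv; have h2 := d_adj vu.
have [E|E|E] := ltngtP (d u) (d v); last by constructor 1; rewrite E.
- have E' : d v = (d u).+1 by apply/eqP; rewrite eqn_leq h1.
  by constructor 2; split=> //; rewrite E'; apply: codeS.
- have E' : d u = (d v).+1 by apply/eqP; rewrite eqn_leq h2.
  by constructor 3; split=> //; rewrite E'; apply: codeS.
Qed.

Lemma code_par v : cd v != 4 -> exists u,
  [/\ adjacent v u, d v = (d u).+1 & cd v = (cd u).+1 \/ (cd v = 0 /\ 7 <= cd u)].
Proof.
move=> H; have /d_par [u vu E] : v != r.
  by apply: contra H; rewrite -d_root => /eqP ->; rewrite code0.
by exists u; split=> //; rewrite E; apply: codeS.
Qed.

Lemma code_par_root v : v != r -> exists u,
  [/\ adjacent v u, d v = (d u).+1 & cd v = (cd u).+1 \/ (cd v = 0 /\ 7 <= cd u)].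
Proof. by case/d_par=> u vu E; exists u; split=> //; rewrite E; apply: codeS. Qed.

Lemma col_white v : ~~ col v -> cd v = 0 /\ ~~ has_child v \/ cd v = 3 \/ 5 <= cd v.
Proof. by rewrite /col; case: (cd v) => [|[|[|[|[|k]]]]] //=; auto. Qed.

Lemma col_black v : col v -> cd v = 0 /\ has_child v \/ cd v = 1 \/ cd v = 2 \/ cd v = 4.
Proof. by rewrite /col; case: (cd v) => [|[|[|[|[|k]]]]] //=; auto. Qed.

Lemma colE v : col v = [|| cd v == 1, cd v == 2, cd v == 4 | (cd v == 0) && has_child v].
Proof. by []. Qed.

Lemma has_childP v u : adjacent v u -> d u = (d v).+1 -> has_child v.
Proof. by move=> vu E; apply/existsP; exists u; rewrite vu E /=. Qed.

Lemma has_childE v : has_child v -> exists2 u, adjacent v u & d u = (d v).+1.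
Proof. by case/existsP => u /andP [vu /eqP E]; exists u. Qed.

Lemma mid_nbr_black v u : cd v = 1 -> adjacent v u -> col u.
Proof.
move=> v1 vu; rewrite colE; case: (nbr_codes vu) => [[E H]|[E H]|[E H]].
- by rewrite E v1.
- have -> : cd u = 2 by lia.
  by [].
- have -> : cd u = 0 by lia.
  by rewrite (has_childP _ E) // adjacent_sym.
Qed.

Lemma seed_white_nbr v : cd v = 4 -> exists2 u, adjacent v u & ~~ col u.
Proof.
move=> v4; have [->|/code_par_root [u [vu E H]]] := eqVneq v r.
  have [u ru u1] := root_child; exists u => //.
  have d0 : d r = 0 by apply/eqP; rewrite d_root.
  have := nbr_codes ru; rewrite u1 d0 code0 => H.
  by rewrite colE u1; have -> : code 1 = 5 by case: H => [|[_]|[]]; lia.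
exists u => //; rewrite colE; have -> : cd u = 3 by lia.
by [].
Qed.

Lemma sat_no_white_nbr q v : sat col q no_white_nbr v -> forall u, adjacent v u -> col u.
Proof.
rewrite sat_Not => H u vu; apply: contraR H => cu.
by apply/sat_DiaP; exists u => //; rewrite sat_Not.
Qed.

(** A black node of code 0 has a child in the middle layer, a node of code 2 has its parent there,
    and neither may be next to one. The black neighbours of a node of code 4 have code 4 too, and so
    have white neighbours. *)
Lemma sat_isB q v : sat col q isB v = (cd v == 4).
Proof.
rewrite !sat_And sat_Blk sat_Not; apply/idP/idP => [/and3P [cv wv nv]|/eqP v4].
  apply: contraR nv => v4.
  have mid u : adjacent v u -> cd u = 1 -> sat col q (Dia false (And Blk no_white_nbr)) v.
    move=> vu u1; apply/sat_DiaP; exists u => //.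
    rewrite sat_And sat_Blk colE u1 sat_Not; apply/sat_DiaP => -[w uw].
    by rewrite sat_Not sat_Blk (mid_nbr_black u1).
  case: (col_black cv) => [[v0 /has_childE [u vu du]]|[v1|[v2|/eqP]]].
  - apply: (mid u vu); case: (nbr_codes vu) => [||[]]; lia.
  - case/sat_DiaP: wv => u vu; by rewrite sat_Not sat_Blk (mid_nbr_black v1).
  - by have [u [vu E H]] := code_par v4; apply: (mid u vu); lia.
  - by rewrite (negbTE v4).
have cv : col v by rewrite colE v4.
have [u vu cu] := seed_white_nbr v4; rewrite cv andTb; apply/andP; split.
  by apply/sat_DiaP; exists u => //; rewrite sat_Not.
apply/sat_DiaP => -[w vw]; rewrite sat_And sat_Blk => /andP [cw /sat_no_white_nbr aw].
have w4 : cd w = 4.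
  case: (nbr_codes vw) (col_black cw) => [[_ H]|[_ H]|[_ H]]; lia.
by have [x wx] := seed_white_nbr w4; rewrite aw.
Qed.

Lemma sat_isTriple q v : sat col q isTriple v = col v && (cd v != 4).
Proof. by rewrite sat_And sat_Not sat_isB. Qed.

(** White walks of length two from code 2 stay in code 3, next to black parents. Above code 0 lie
    codes at least 7 and then 6, and a node of the latter sees only codes at least 5, all white:
    this is the use of 7 in [codeS]. *)
Lemma sat_isTop q v : sat col q isTop v = col v && (cd v == 0).
Proof.
rewrite sat_And sat_isTriple; case cv: (col v) => //=.
apply/andP/eqP => [[v4 /sat_DiaP [u vu]]|v0].
  rewrite !sat_And sat_Not sat_Blk => /andP [cu /sat_DiaP [w uw]].
  rewrite sat_And !sat_Not sat_Blk => /andP [cw nw].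
  case: (col_black cv) => [[//]|[v1|[v2|E]]]; last by rewrite E in v4.
    by rewrite (mid_nbr_black v1 vu) in cu.
  have u3 : cd u = 3.
    by case: (col_white cu) (nbr_codes vu) => [[E _]|[//|E]] [[_ ?]|[_ ?]|[_ ?]]; lia.
  have w3 : cd w = 3.
    by case: (col_white cw) (nbr_codes uw) => [[E _]|[//|E]] [[_ ?]|[_ ?]|[_ ?]]; lia.
  have [|x [wx _ H]] := @code_par w; first by rewrite w3.
  case/sat_DiaP: nw; exists x => //; rewrite sat_Blk colE.
  by have -> : cd x = 2 by lia.
rewrite v0; split=> //.
have [|u [vu dv Hu]] := @code_par v; first by rewrite v0.
have {Hu} Hu : 7 <= cd u by lia.
have [|w [uw du Hw]] := @code_par u; first by lia.
have {}Hw : cd u = (cd w).+1 by lia.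
have [|x [_ dw Hx]] := @code_par w; first by lia.
apply/sat_DiaP; exists u => //; rewrite sat_And sat_Not sat_Blk; apply/andP; split.
  by rewrite colE; lia.
apply/sat_DiaP; exists w => //; rewrite sat_And !sat_Not sat_Blk; apply/andP; split.
  by rewrite colE; lia.
apply/sat_DiaP => -[y wy]; rewrite sat_Blk => /col_black.
have H : 5 <= cd y.
  case: (nbr_codes wy) => [[_ ->]|[E _]|[E H]]; try lia.
  by rewrite E -du; lia.
by lia.
Qed.

Lemma sat_isMid q v : sat col q isMid v = (cd v == 1).
Proof.
rewrite sat_And sat_And sat_Not sat_isTriple sat_isTop; apply/idP/eqP => [|v1].
  move=> /andP [/andP [/andP [cv v4] v0] /sat_DiaP [u vu]].
  rewrite sat_isTop => /andP [_ /eqP u0]; move: v0; rewrite cv /= => v0.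
  by case: (nbr_codes vu) (col_black cv); lia.
have [|u [vu dv H]] := @code_par v; first by rewrite v1.
have u0 : cd u = 0 by lia.
rewrite colE v1 /=; apply/sat_DiaP; exists u => //.
by rewrite sat_isTop colE u0 /= (@has_childP u v) // adjacent_sym.
Qed.

Lemma sat_isOff q v : sat col q isOff v = (cd v == 3).
Proof.
rewrite sat_And sat_Not sat_Blk; apply/idP/eqP => [/andP [cv /sat_DiaP [u vu]]|v3].
  rewrite sat_And sat_Not sat_isTriple sat_isTop => /andP [/andP [cu u4]].
  rewrite cu /= => u0; case: (nbr_codes vu) => [[_ ?]|[E H]|[_ ?]].
  - by case: (col_white cv) (col_black cu) => [[]|[|]]; lia.
  - case: (col_white cv) (col_black cu) => [[v0 nc]|[|]]; try lia.
    by rewrite (has_childP vu E) in nc.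
  - by case: (col_white cv) (col_black cu) => [[]|[|]]; lia.
have [|u [vu dv H]] := @code_par v; first by rewrite v3.
have u2 : cd u = 2 by lia.
rewrite colE v3 /=; apply/sat_DiaP; exists u => //.
by rewrite sat_And sat_Not sat_isTop sat_isTriple colE u2.
Qed.

(** Any other node of code 4 has a parent of code 3, while [r] sees no code but 4 and 5. *)
Lemma sat_isRoot q v : sat col q isRoot v = (v == r).
Proof.
rewrite sat_And sat_Not sat_isB -d_root; apply/andP/eqP => [[/eqP v4 H]|v0].
  apply/eqP; rewrite d_root; apply: contraR H => /code_par_root [u [vu _ H]].
  by apply/sat_DiaP; exists u => //; rewrite sat_isOff; apply/eqP; lia.
rewrite v0 code0; split=> //; apply/sat_DiaP => -[u vu]; rewrite sat_isOff.
by case: (nbr_codes vu); rewrite v0 code0; lia.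
Qed.

(* White nodes of code 0 have no child and continue the white zone above them. *)
Definition depth_code (v : node G) := if cd v == 0 then (code (d v).-1).+1 else cd v.

(** Code 3 is excluded because it may touch the next isolated layer from above. *)
Definition leveled (v : node G) := (cd v == 4) || ~~ col v && (cd v != 3).

Lemma leveled_nbr u v : adjacent v u -> leveled v -> ~~ col v -> ~~ col u -> leveled u.
Proof.
move=> vu; rewrite /leveled => + cv cu; rewrite cv cu /=.
by case: (col_white cv) (col_white cu) (nbr_codes vu) => [[? _]|[?|?]] [[? _]|[?|?]]
  [[_ ?]|[_ ?]|[_ ?]]; lia.
Qed.

Lemma depth_code_nbr u v : adjacent v u -> leveled v -> leveled u -> ~~ col v ->
  [\/ d u = d v /\ depth_code u = depth_code v,
      d v = (d u).+1 /\ depth_code v = (depth_code u).+1 |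
      d u = (d v).+1 /\ depth_code u = (depth_code v).+1].
Proof.
move=> vu lv lu cv; rewrite /depth_code.
case: (nbr_codes vu) => [[E H]|[E H]|[E H]].
- by constructor 1; rewrite E.
- constructor 3; split=> //; rewrite E /= in H *.
  have nv0 : cd v <> 0.
    move=> v0; case: (col_white cv) => [[_ /negP []]|]; last by lia.
    exact: has_childP vu E.
  by do 2!case: ifP => ?; lia.
- constructor 2; split=> //; rewrite E /= in H *.
  have nu0 : cd u <> 0.
    move=> u0; case/orP: lu => [|/andP [cu _]]; first by rewrite u0.
    case: (col_white cu) => [[_ /negP []]|]; last by lia.
    by apply: (has_childP _ E); rewrite adjacent_sym.
  by do 2!case: ifP => ?; lia.
Qed.

Lemma depth_code_white v : leveled v -> ~~ col v -> 5 <= depth_code v.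
Proof.
rewrite /depth_code /leveled => + cv; rewrite cv /=.
case: ifP => [/eqP v0 _|v0]; last by case: (col_white cv) => [[]|[|]]; lia.
have [|u [vu dv H]] := @code_par v; first by rewrite v0.
by rewrite dv /=; lia.
Qed.

Lemma leveled_par v : leveled v -> ~~ col v -> exists u,
  [/\ adjacent v u, d v = (d u).+1, leveled u & depth_code v = (depth_code u).+1].
Proof.
move=> lv cv; have v4 : cd v != 4 by apply: contraNneq cv => v4; rewrite colE v4.
have [u [vu dv H]] := code_par v4.
have lu : leveled u.
  move: lv; rewrite /leveled cv /= (negbTE v4) /= => v3; rewrite colE.
  by case: (col_white cv) => [[v0 _]|[|]]; lia.
exists u; split=> //.
by case: (depth_code_nbr vu lv lu cv) => -[E ?]; move: dv; rewrite ?E; lia.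
Qed.

(** A step of a white walk from a leveled node changes [depth_code] by at most one and never enters
    code 3; the walk ends at depth 4. *)
Lemma sat_level_ge q j v : leveled v -> sat col q (level j) v -> depth_code v <= j + 4.
Proof.
elim: j v => [|j IH] v lv.
  by rewrite sat_isB /depth_code => /eqP ->.
rewrite sat_And sat_Not sat_Blk => /andP [cv /sat_DiaP [u vu uj]].
have lu : leveled u.
  case: j uj {IH} => [|j]; first by rewrite sat_isB /leveled => ->.
  by rewrite sat_And sat_Not => /andP [cu _]; apply: leveled_nbr vu _ _ _.
have := IH _ lu uj; case: (depth_code_nbr vu lv lu cv) => -[_]; lia.
Qed.

Lemma sat_level q v : leveled v -> sat col q (level (depth_code v - 4)) v.
Proof.
have [n] := ubnP (d v); elim: n v => // n IH v ln lv.
case cv: (col v).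
  have v4 : cd v = 4 by move: lv; rewrite /leveled cv orbF => /eqP.
  by rewrite /depth_code v4 /= sat_isB v4.
have [u [vu dv lu ->]] := leveled_par lv (negbT cv).
have u4 : 4 <= depth_code u.
  case cu: (col u); last by have := depth_code_white lu (negbT cu); lia.
  by move: lu; rewrite /leveled cu orbF /depth_code => /eqP ->.
rewrite subSn // sat_And sat_Not sat_Blk cv; apply/sat_DiaP; exists u => //.
by apply: IH => //; lia.
Qed.

Definition parent_form (v : node G) : form :=
  if cd v == 4 then isOff
  else if col v then
    (if cd v == 0 then Not Blk else if cd v == 1 then isTop else isMid)
  else if cd v == 3 then isTriple else level (depth_code v - 5).

Lemma port_free_parent v : port_free (parent_form v).
Proof.
by rewrite /parent_form; do !case: ifP => _ //; apply: port_free_level.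
Qed.

Lemma sat_find_level q k j v : leveled v -> ~~ col v -> j <= depth_code v - 4 < j + k ->
  sat col q (find_level k j) v = sat col q (Dia true (level (depth_code v - 5))) v.
Proof.
move=> lv cv; have v5 := depth_code_white lv cv.
elim: k j => [|k IH] j H; first by lia.
rewrite [find_level _ _]/= sat_If; case: ifP => [/(sat_level_ge lv) le|nj].
  by rewrite (_ : j.-1 = depth_code v - 5) //; lia.
apply: IH; have : j != depth_code v - 4.
  by apply: contraFneq nj => ->; apply: sat_level.
lia.
Qed.

Lemma sat_isParent J q v : depth_code v <= J + 4 ->
  sat col q (isParent J) v = sat col q (Dia true (parent_form v)) v.
Proof.
move=> vJ; rewrite sat_If sat_isB /parent_form; case v4: (cd v == 4) => //.
rewrite sat_If sat_isTop; case cv: (col v) => /=.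
  case: ifP => // _; rewrite sat_If sat_isMid; case: ifP => // _.
  by rewrite sat_If sat_Blk cv.
have v1 : cd v == 1 = false by apply: contraFF cv; rewrite colE => /eqP ->.
rewrite sat_If sat_isMid v1 sat_If sat_Blk cv sat_If sat_isOff.
case v3: (cd v == 3) => //.
have lv : leveled v by rewrite /leveled cv v3 orbT.
have v5 := depth_code_white lv (negbT cv).
by rewrite sat_find_level ?cv //; lia.
Qed.

(* The parent of a black node of code 0 may be a white node of the same layer. *)
Definition rank (v : node G) := 2 * d v + col v.

(** The robot takes the first port that fits, so every fitting neighbour has to decrease the
    rank. *)
Lemma parent_form_rank q v u : adjacent v u -> sat col q (parent_form v) u -> rank u < rank v.
Proof.
move=> vu.
suff H : sat col q (parent_form v) u -> d u < d v \/ [/\ d u = d v, col v & ~~ col u].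
  by rewrite /rank => /H [|[-> -> /negbTE ->]]; lia.
rewrite /parent_form; case: eqP => [v4|v4].
  by rewrite sat_isOff => /eqP u3; left; case: (nbr_codes vu); lia.
case cv: (col v).
  case: eqP => [v0|v0].
    rewrite sat_Not sat_Blk => cu.
    by case: (nbr_codes vu) => [[E _]|[_ ?]|[E _]];
      [right | case: (col_white cu); lia | left; rewrite E].
  case: eqP => [v1|v1].
    rewrite sat_isTop => /andP [_ /eqP u0]; left.
    by case: (nbr_codes vu); lia.
  rewrite sat_isMid => /eqP u1; left.
  by case: (nbr_codes vu) (col_black cv); lia.
case: eqP => [v3|v3].
  rewrite sat_isTriple => /andP [cu /eqP u4]; left.
  by case: (nbr_codes vu) (col_black cu); lia.
have lv : leveled v by rewrite /leveled cv; apply/orP; right; apply/eqP.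
have v5 := depth_code_white lv (negbT cv).
move=> Hu; left; have lu : leveled u.
  move: Hu; case: (_ - 5) => [|j]; first by rewrite sat_isB /leveled => ->.
  by rewrite sat_And sat_Not sat_Blk => /andP [cu _]; apply: leveled_nbr vu _ _ _; rewrite ?cv.
have := sat_level_ge lu Hu.
by case: (depth_code_nbr vu lv lu (negbT cv)); lia.
Qed.

Lemma parent_form_ex v : v != r -> exists2 u, adjacent v u & sat col 0 (parent_form v) u.
Proof.
move=> /code_par_root [u [vu dv H]]; rewrite /parent_form.
case: eqP => [v4|v4].
  by exists u => //; rewrite sat_isOff; apply/eqP; lia.
case cv: (col v).
  case: eqP => [v0|v0].
    by exists u => //; rewrite sat_Not sat_Blk colE; lia.
  case: eqP => [v1|v1].
    exists u => //; rewrite sat_isTop colE; have -> : cd u = 0 by lia.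
    by rewrite (@has_childP u v) // adjacent_sym.
  exists u => //; rewrite sat_isMid; apply/eqP.
  by case: (col_black cv); lia.
case: eqP => [v3|v3].
  exists u => //; rewrite sat_isTriple colE; have -> : cd u = 2 by lia.
  by [].
have lv : leveled v by rewrite /leveled cv; apply/orP; right; apply/eqP.
have [w [vw _ lw ->]] := leveled_par lv (negbT cv).
by exists w => //; rewrite subSS; apply: sat_level.
Qed.

Lemma parent_form_root u : adjacent r u -> ~~ sat col 0 (parent_form r) u.
Proof.
have dr : d r = 0 by apply/eqP; rewrite d_root.
move=> ru; apply/negP => /(parent_form_rank ru); rewrite /rank dr => H.
have cr : col r by rewrite colE dr code0.
have /eqP : d u = 0 by lia.
by rewrite d_root => /eqP E; move: H; rewrite E dr cr.
Qed.
End Layers.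
End Decoding.

(** * Evaluation time *)

Section Costs.
Local Open Scope nat_scope.
Variables (D : nat).
Hypothesis D2 : 2 <= D.

Fixpoint cost (f : form) : nat :=
  match f with
  | Cst _ | Blk => 0
  | If f g h => cost f + maxn (cost g) (cost h)
  | Dia _ f => D * (cost f + 2)
  end.

Lemma cost_Not f : cost (Not f) = cost f.
Proof. by rewrite /= addn0. Qed.

Lemma cost_And f g : cost (And f g) = cost f + cost g.
Proof. by rewrite /= maxn0. Qed.

Lemma leq_pow a m n : m <= n -> a * D ^ m <= a * D ^ n.
Proof. by move=> mn; rewrite leq_mul2l leq_pexp2l ?orbT //; lia. Qed.

Lemma cost_Dia m f a e b e' : a + 2 <= b -> e < e' ->
  cost f <= a * D ^ e -> cost (Dia m f) <= b * D ^ e'.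
Proof.
move=> ab ee H; apply: leq_trans (leq_pow _ ee); rewrite expnS mulnCA /= leq_mul2l.
have De : 1 <= D ^ e by rewrite expn_gt0; lia.
by apply/orP; right; nia.
Qed.

Lemma cost_isB : cost isB <= 6 * D ^ 2.
Proof.
rewrite !cost_And cost_Not.
have h1 : cost no_white_nbr <= 2 * D ^ 1.
  by rewrite cost_Not; apply: (@cost_Dia _ _ 0 0).
have h2 : cost (Dia false (And Blk no_white_nbr)) <= 4 * D ^ 2.
  by apply: (@cost_Dia _ _ 2 1) => //; rewrite cost_And.
have h3 : cost (Dia false (Not Blk)) <= 2 * D ^ 2 by apply: (@cost_Dia _ _ 0 0).
change (cost Blk) with 0; lia.
Qed.

Lemma cost_isTriple : cost isTriple <= 6 * D ^ 2.
Proof. by rewrite cost_And cost_Not cost_isB. Qed.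

Lemma cost_isTop : cost isTop <= 12 * D ^ 3.
Proof.
rewrite cost_And (_ : 12 = 6 + 6) // mulnDl leq_add //.
  exact: leq_trans cost_isTriple (leq_pow _ _).
apply: (@cost_Dia _ _ 4 2) => //; rewrite cost_And cost_Not add0n.
apply: (@cost_Dia _ _ 2 1) => //; rewrite cost_And cost_Not add0n cost_Not.
exact: (@cost_Dia _ _ 0 0).
Qed.

Lemma cost_nonTop : cost (And isTriple (Not isTop)) <= 18 * D ^ 3.
Proof.
rewrite cost_And cost_Not (_ : 18 = 6 + 12) // mulnDl leq_add //; last exact: cost_isTop.
exact: leq_trans cost_isTriple (leq_pow _ _).
Qed.

Lemma cost_isMid : cost isMid <= 32 * D ^ 4.
Proof.
rewrite cost_And (_ : 32 = 18 + 14) // mulnDl leq_add //.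
  exact: leq_trans cost_nonTop (leq_pow _ _).
exact: cost_Dia cost_isTop.
Qed.

Lemma cost_isOff : cost isOff <= 20 * D ^ 4.
Proof. by rewrite cost_And cost_Not; apply: cost_Dia cost_nonTop. Qed.

(** The summand 4 makes the induction work: [D * (c + 2) + 4 <= D * (c + 4)] when [2 <= D]. *)
Lemma cost_level j : cost (level j) + 4 <= 8 * D ^ (j + 2).
Proof.
elim: j => [|j IH].
  have := cost_isB; have : D ^ 2 = D * D by rewrite expnS expn1.
  rewrite add0n /level; nia.
rewrite [level _]/= cost_And cost_Not addSn expnS.
change (cost Blk + cost (Dia false (level j))) with (0 + D * (cost (level j) + 2)).
nia.
Qed.

Section EvalTime.
Variables (G : pgraph) (col : node G -> bool).
Hypothesis degD : forall v : node G, deg v <= D.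

Lemma eval_time_cost q f v : eval_time col q f v <= cost f.
Proof.
elim: f v => [//|//|f IHf g IHg h IHh|m f IHf] v /=.
  rewrite leq_add //; case: ifP => _; first exact: leq_trans (IHg v) (leq_maxl _ _).
  exact: leq_trans (IHh v) (leq_maxr _ _).
apply: (@leq_trans (\sum_(0 <= i < deg v) (cost f + 2))).
  by apply: leq_sum => i _; rewrite leq_add2r.
by rewrite sum_nat_const_nat subn0 leq_mul2r degD orbT.
Qed.

Lemma sum_pow n : \sum_(0 <= i < n.+1) D ^ i <= 2 * D ^ n.
Proof.
elim: n => [|n IH]; first by rewrite big_nat1.
by rewrite big_nat_recr //=; move: IH; rewrite expnS; nia.
Qed.

(** The search cannot pass [L], where the test succeeds; the last term pays for probing the
    neighbours once. *)
Lemma find_level_time q k j v L : sat col q (level L) v -> j <= L ->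
  eval_time col q (find_level k j) v <=
    \sum_(j <= i < L.+1) 8 * D ^ (i + 2) + D * (8 * D ^ (L.-1 + 2)).
Proof.
move=> HL; elim: k j => [//|k IH] j jL.
rewrite [find_level _ _]/= big_ltn //; set S := \sum_(_ <= _ < _) _.
have h : eval_time col q (level j) v <= 8 * D ^ (j + 2).
  by apply: leq_trans (eval_time_cost _ _ _) _; have := cost_level j; lia.
suff h2 : (if sat col q (level j) v then eval_time col q (Dia true (level j.-1)) v
          else eval_time col q (find_level k j.+1) v) <= S + D * (8 * D ^ (L.-1 + 2)).
  by rewrite -addnA leq_add.
case: ifP => [_|jF].
  apply: leq_trans (eval_time_cost _ _ _) _; rewrite /= (leq_trans _ (leq_addl _ _)) //.
  rewrite leq_mul2l; apply/orP; right; have := cost_level j.-1.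
  have : D ^ (j.-1 + 2) <= D ^ (L.-1 + 2) by rewrite leq_pexp2l; lia.
  lia.
apply: IH; rewrite ltn_neqAle jL andbT; apply: contraFneq jF => -> //.
Qed.

Lemma find_level_time_le q k v L : 0 < L -> sat col q (level L) v ->
  eval_time col q (find_level k 1) v <= 24 * D ^ (L + 2).
Proof.
move=> L0 HL; apply: leq_trans (find_level_time _ HL L0) _.
have -> : D * (8 * D ^ (L.-1 + 2)) = 8 * D ^ (L + 2).
  by rewrite mulnCA -expnS; congr (_ * D ^ _); lia.
(* 16 is 8 times the factor 2 of the geometric sum; 8 is the final probe. *)
rewrite (_ : 24 = 16 + 8) // mulnDl leq_add2r.
apply: (@leq_trans (\sum_(0 <= i < L.+1) 8 * D ^ (i + 2))).
  by rewrite [X in _ <= X]big_ltn // leq_addl.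
under eq_bigr => i _ do rewrite expnD mulnA mulnAC.
rewrite -big_distrr /= expnD; have := sum_pow L; nia.
Qed.

End EvalTime.
End Costs.

(** * Number of moves of the tour for a given layering *)

Section Exploration.
Local Open Scope nat_scope.
Local Arguments sat : simpl never.
Local Arguments eval_time : simpl never.
Variables (G : pgraph) (r : node G) (d : node G -> nat).
Hypothesis d_root : forall v, (d v == 0) = (v == r).
Hypothesis d_adj : forall u v, adjacent u v -> d v <= (d u).+1.
Hypothesis d_par : forall v, v != r -> exists2 u, adjacent v u & d v = (d u).+1.
Hypothesis root_child : exists2 u, adjacent r u & d u = 1.
Variable code : nat -> nat.
Hypothesis code0 : code 0 = 4.
Hypothesis codeS : forall k, code k.+1 = (code k).+1 \/ (code k.+1 = 0 /\ 7 <= code k).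

Notation col := (layer_color d code).

Variables (D J : nat).
Hypothesis D2 : 2 <= D.
Hypothesis degD : forall v : node G, deg v <= D.
Hypothesis codeJ : forall v, depth_code d code v <= J + 4.

(** The constant is [6 + 12 + 32 + 20] for the tests and 34 for the probe that follows. A white node
    at depth code [c] costs of order [D ^ (c - 2)], whence [e + 2]. *)
Lemma isParent_time q v e : 5 <= e -> depth_code d code v <= e + 2 ->
  eval_time col q (isParent J) v <= 104 * D ^ e.
Proof.
move=> e5 ve.
have P a n : n <= 5 -> a * D ^ n <= a * D ^ e by move=> n5; rewrite leq_pow //; lia.
have T f a n : cost D f <= a * D ^ n -> n <= 5 -> eval_time col q f v <= a * D ^ e.
  move=> fa /(P a); apply: leq_trans; apply: leq_trans fa.
  exact: eval_time_cost degD _ _ _.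
have B1 := T _ _ _ (cost_isB D2) isT.
have B2 := T _ _ _ (cost_isTop D2) isT.
have B3 := T _ _ _ (cost_isMid D2) isT.
have B4 := T _ _ _ (cost_isOff D2) isT.
have TD f a n : cost D f <= a * D ^ n -> n < 5 -> a <= 32 ->
    eval_time col q (Dia true f) v <= 34 * D ^ e.
  by move=> cf n5 a32; apply: (T _ _ n.+1) => //; apply: (cost_Dia D2 _ _ _ cf); lia.
have E f g h : eval_time col q (If f g h) v = eval_time col q f v +
    (if sat col q f v then eval_time col q g v else eval_time col q h v) by [].
rewrite /isParent E; case: ifP => _.
  by have := TD _ _ _ (cost_isOff D2) isT isT; lia.
rewrite E; case: ifP => _; first by have := TD (Not Blk) 0 0 isT isT isT; lia.
rewrite E; case: ifP => _; first by have := TD _ _ _ (cost_isTop D2) isT isT; lia.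
rewrite E (_ : eval_time col q Blk v = 0) // add0n; case: ifP => cv.
  by have := TD _ _ _ (cost_isMid D2) isT isT; lia.
rewrite E; case: ifP => ov; first by have := TD _ _ _ (cost_isTriple D2) isT isT; lia.
have {}cv : ~~ col v by apply/negbT.
have lv : leveled d code v.
  rewrite /leveled cv /=; apply/orP; right.
  by rewrite -(sat_isOff d_root d_adj d_par root_child code0 codeS q) ov.
have v5 := depth_code_white d_root d_par code0 codeS lv cv.
have L := sat_level d_root d_adj d_par root_child code0 codeS q lv.
have L0 : 0 < depth_code d code v - 4 by lia.
have := find_level_time_le D2 degD J L0 L.
have : D ^ (depth_code d code v - 4 + 2) <= D ^ e by rewrite leq_pexp2l; lia.
lia.
Qed.

Lemma isRoot_time q v e : 5 <= e -> eval_time col q isRoot v <= 28 * D ^ e.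
Proof.
move=> e5; apply: leq_trans (leq_pow D2 28 e5).
apply: leq_trans (eval_time_cost _ degD _ _ _) _.
rewrite cost_And cost_Not (_ : 28 = 6 + 22) // mulnDl leq_add //.
  exact: leq_trans (cost_isB D2) (leq_pow D2 _ _).
by apply: (cost_Dia D2 _ _ _ (cost_isOff D2)).
Qed.

(** A pair at [v] also pays for an evaluation at a neighbour, hence the third hypothesis; 212 covers
    [2 * 104 + 3]. *)
Lemma layers_explore (e : node G -> nat) :
  (forall v, 5 <= e v) -> (forall v, depth_code d code v <= e v + 2) ->
  (forall u v, adjacent v u -> depth_code d code u <= e v + 2) ->
  exists2 T, explores_in (tour_robot D (isParent J) isRoot) col r T &
    T <= D.+1 * \sum_(v : node G) 212 * D ^ e v.
Proof.
move=> e5 ev eu.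
have isP v p : isparent (isParent J) col v p = sat col p (Dia true (parent_form d code v)) v.
  by rewrite /isparent (sat_isParent d_root d_adj d_par root_child code0 codeS).
have adjp (v : node G) p : p < deg v -> adjacent v (adj v p).1 by move=> pv; apply/adjacentP; exists p.
have pf := port_free_parent d code.
have [|||||||T HT leT] := @tour_explores D (isParent J) isRoot G col degD _ r (rank d code).
- move=> v; have [->|/d_par [u /adjacentP [i iv _] _]] := eqVneq v r; last by lia.
  by have [u /adjacentP [i iv _] _] := root_child; lia.
- by move=> v; rewrite /isroot (sat_isRoot d_root d_adj d_par root_child code0 codeS).
- by move=> v p; rewrite isP => /sat_firstP [].
- by move=> v p p'; rewrite !isP; apply: sat_first_uniq.
- move=> p; rewrite isP; apply/negP => /sat_firstP [pr].
  rewrite (sat_port_free _ _ 0) //; apply/negP.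
  by apply: (parent_form_root d_root d_adj d_par root_child code0 codeS); apply: adjp.
- move=> v vr.
  have [u vu fu] := parent_form_ex d_root d_adj d_par root_child code0 codeS vr.
  by have [p Hp] := sat_first_ex (pf v) vu fu; exists p; rewrite isP.
- move=> v p; rewrite isP => /sat_firstP [pv].
  by apply: (parent_form_rank d_root d_adj d_par root_child code0 codeS); apply: adjp.
exists T => //; apply: leq_trans leT _; rewrite big_distrr /=; apply: leq_sum => v _.
rewrite -[X in X * _]card_ord -sum_nat_const; apply: leq_sum => p _.
rewrite /port_cost.
have := isParent_time p (e5 v) (ev v).
have : 1 <= D ^ e v by rewrite expn_gt0; lia.
case: ifP => pv; last by have := isRoot_time 0 v (e5 v); lia.
by have := isParent_time (adj v p).2 (e5 v) (eu _ _ (adjp _ _ pv)); lia.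
Qed.
End Exploration.

(** * Distance and choice of the coloring *)

Section Distance.
Local Open Scope nat_scope.
Variables (G : pgraph) (r : node G).
Hypothesis Gconn : gconnected G.

(** Boolean membership lets [ex_minn] define the distance. *)
Fixpoint ball (k : nat) : {set node G} :=
  if k is k'.+1 then r |: [set v | [exists u in ball k', adjacent u v]] else [set r].

Lemma ball_root k : r \in ball k.
Proof. by case: k => [|k]; rewrite !inE eqxx. Qed.

Lemma ball_adj k u v : u \in ball k -> adjacent u v -> v \in ball k.+1.
Proof.
move=> uk uv; rewrite /= !inE; apply/orP; right.
by apply/existsP; exists u; rewrite uk.
Qed.

Lemma ballS k v : v \in ball k.+1 -> v = r \/ exists2 u, u \in ball k & adjacent u v.
Proof.
rewrite /= !inE => /predU1P [->|/existsP [u /andP [uk uv]]]; first by left.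
by right; exists u.
Qed.

Lemma ball_sub k l v : k <= l -> v \in ball k -> v \in ball l.
Proof.
elim: k l v => [|k IH] [|l] v //; first by rewrite inE => _ /eqP ->; apply: ball_root.
by move=> kl /ballS [->|[u uk /ball_adj]]; [apply: ball_root | apply; apply: IH].
Qed.

Lemma ball_path k u p : u \in ball k -> path (@adjacent G) u p -> last u p \in ball (k + size p).
Proof.
elim: p u k => [|v p IH] u k uk /=; first by rewrite addn0.
by move=> /andP [uv /IH]; rewrite addnS -addSn; apply; apply: ball_adj uv.
Qed.

Lemma ball_exists v : exists k, v \in ball k.
Proof.
have [p [rp <-]] := Gconn r v; exists (size p).
exact: (@ball_path 0) (ball_root 0) rp.
Qed.

Lemma ball_reach k v : v \in ball k -> reach_within k r v.
Proof.
elim: k v => [|k IH] v; first by rewrite inE => /eqP ->; exists [::].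
move=> /ballS [->|[u /IH [p [rp lp sp]] uv]]; first by exists [::].
exists (rcons p v); split; last by rewrite size_rcons.
  by rewrite rcons_path rp lp.
by rewrite last_rcons.
Qed.

(** Strictness carries the induction: [1 + D * b < D * (b + 1)] leaves room for the root. *)
Lemma card_ball D k : 2 <= D -> (forall v : node G, deg v <= D) -> #|ball k| < 2 * D ^ k.
Proof.
move=> D2 degD; elim: k => [|k IH]; first by rewrite cards1.
have sub : ball k.+1 \subset
    r |: [set (adj x.1 (nat_of_ord x.2)).1 | x in setX (ball k) [set: 'I_D]].
  apply/subsetP => v /ballS [->|[u uk /adjacentP [i iu <-]]]; first by rewrite !inE eqxx.
  rewrite inE; apply/orP; right; apply/imsetP.
  by exists (u, Ordinal (leq_trans iu (degD u))); rewrite ?inE ?uk.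
have := subset_leq_card sub; rewrite cardsU1.
have := leq_imset_card (fun x : node G * 'I_D => (adj x.1 (nat_of_ord x.2)).1)
  (setX (ball k) [set: 'I_D]).
rewrite cardsX cardsT card_ord; set U := [set _ | _ in _] => hU hS.
have {hS} : #|ball k.+1| <= 1 + #|U| by apply: leq_trans hS _; rewrite leq_add2r leq_b1.
have : (#|ball k|.+1) * D <= 2 * D ^ k * D by rewrite leq_mul2r IH orbT.
rewrite mulSn -mulnA -expnSr; lia.
Qed.

Definition gdist (v : node G) : nat := ex_minn (ball_exists v).

Lemma dist_ball v k : (gdist v <= k) = (v \in ball k).
Proof.
rewrite /gdist; case: ex_minnP => n vn min; apply/idP/idP => [nk|/min //].
exact: ball_sub vn.
Qed.

Lemma dist_root v : (gdist v == 0) = (v == r).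
Proof. by rewrite -leqn0 dist_ball inE. Qed.

Lemma dist_adj u v : adjacent u v -> gdist v <= (gdist u).+1.
Proof. by rewrite dist_ball; apply: ball_adj; rewrite -dist_ball. Qed.

Lemma dist_par v : v != r -> exists2 u, adjacent v u & gdist v = (gdist u).+1.
Proof.
move=> vr; case E: (gdist v) => [|k]; first by rewrite -dist_root E in vr.
have := leqnn (gdist v); rewrite {2}E dist_ball => /ballS [ve|[u]]; first by rewrite ve eqxx in vr.
rewrite -dist_ball => uk uv; exists u; first by rewrite adjacent_sym.
by have := dist_adj uv; rewrite E; lia.
Qed.

Lemma dist_level v k : k <= gdist v -> exists u, gdist u = k.
Proof.
have [n] := ubnP (gdist v); elim: n v => // n IH v ln.
rewrite leq_eqVlt => /predU1P [->|lt]; first by exists v.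
have vr : v != r by rewrite -dist_root; lia.
by have [u _ E] := dist_par vr; apply: (IH u); lia.
Qed.

Lemma card_dist_lt v k : k <= (gdist v).+1 -> k <= #|[set u | gdist u < k]|.
Proof.
elim: k => // k IH kv; have [u uk] := @dist_level v k kv.
have -> : [set u | gdist u < k.+1] = [set u | gdist u < k] :|: [set u | gdist u == k].
  by apply/setP => w; rewrite !inE ltnS leq_eqVlt orbC.
rewrite cardsU; have -> : [set u | gdist u < k] :&: [set u | gdist u == k] = set0.
  by apply/setP => w; rewrite !inE; lia.
rewrite cards0 subn0.
have : 0 < #|[set u | gdist u == k]| by apply/card_gt0P; exists u; rewrite inE uk.
by have := IH (ltnW kv); lia.
Qed.

End Distance.

Section Code.
Local Open Scope nat_scope.
Variables (m P : nat).
Hypothesis m5 : 5 <= m.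
Hypothesis P9 : 9 <= P.

(** The top zone starts at code 4, so that [r] acts as an isolated layer; the first triple starts at
    layer [m.-1]. *)
Definition lcode (k : nat) : nat := if k < m.-1 then k + 4 else (k - m.-1) %% P.

Lemma lcodeS k : lcode k.+1 = (lcode k).+1 \/ (lcode k.+1 = 0 /\ 7 <= lcode k).
Proof.
rewrite /lcode; case: (ltngtP k.+1 m.-1) => [lt|gt|E].
- by left; lia.
- rewrite subSn; last by lia.
  rewrite modnS; case: ifP => dv; last by left.
  right; split=> //; set x := k - _ in dv *.
  have : x.+1 %% P == 0 := dv.
  rewrite -addn1 -modnDml; have := ltn_pmod x (leq_trans (isT : 0 < 9) P9).
  rewrite leq_eqVlt => /predU1P [|lt]; first by lia.
  by rewrite modn_small; lia.
- rewrite E subnn mod0n; right; split=> //; lia.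
Qed.

Definition lcode_depth (k : nat) := if lcode k == 0 then (lcode k.-1).+1 else lcode k.

Lemma lcode_lt k : m.-1 <= k -> lcode k < P.
Proof. by move=> mk; rewrite /lcode; case: (ltnP k m.-1) => ?; [lia | apply: ltn_pmod; lia]. Qed.

(** The range reaches [m.+1] to cover the neighbours of nodes at distance [m]. *)
Lemma lcode_depth_top k : k <= m.+1 -> lcode_depth k <= m + 3.
Proof.
move=> km; rewrite /lcode_depth /lcode.
case: (ltnP k m.-1) => [lt|ge]; first by rewrite addn_eq0 andbF; lia.
case: (ltngtP k m.-1) ge => // [gt _|-> _]; last first.
  by rewrite subnn mod0n /=; case: ifP; lia.
by rewrite modn_small; [case: ifP; lia | lia].
Qed.

(** Layer [m.-1] is left out: its white nodes prolong the top zone. *)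
Lemma lcode_depth_deep k : m <= k -> lcode_depth k <= P.
Proof.
move=> mk; rewrite /lcode_depth; case: ifP => _; first by apply: lcode_lt; lia.
by apply/ltnW/lcode_lt; lia.
Qed.

End Code.

Section Counting.
Local Open Scope nat_scope.
Variables (G : pgraph) (r : node G) (d : node G -> nat).
Hypothesis d_root : forall v, (d v == 0) = (v == r).
Variables (m0 P : nat).
Hypothesis m0_5 : 5 <= m0.
Hypothesis P9 : 9 <= P.

(** Each residue is attained by at most one offset below [P]. *)
Lemma residues_le x : #|[set i : 'I_P | (i <= x) && ((x - i) %% P \in [:: 0; 1; 2; 4])]| <= 4.
Proof.
set A := [set _ | _]; pose f (i : 'I_P) := (x - i) %% P.
rewrite cardE -(size_map f); apply: (@uniq_leq_size _ _ [:: 0; 1; 2; 4]).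
  rewrite map_inj_in_uniq ?enum_uniq // => i j.
  rewrite !mem_enum !inE => /andP [ix _] /andP [jx _] E; apply/val_inj => /=.
  have : (x - i) + (i + j) == (x - j) + (i + j) %[mod P] by rewrite eqn_modDr; apply/eqP.
  rewrite addnA subnK // [i + j]addnC addnA subnK // eqn_modDl.
  by rewrite !modn_small // => /eqP.
by move=> k /mapP [i]; rewrite mem_enum inE => /andP [_ Hi] ->.
Qed.

(** Double counting: [r] is black for all [P] offsets, any other node for at most four, and for none
    if it is closer than [m0.-1]. *)
Lemma black_sum : \sum_(i < P) #|[pred v | layer_color d (lcode (m0 + i) P) v]| <=
  P + 4 * #|[set v | m0.-1 <= d v]|.
Proof.
pose B (i : 'I_P) v := (m0.-1 + i <= d v) && ((d v - (m0.-1 + i)) %% P \in [:: 0; 1; 2; 4]).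
apply: (@leq_trans (\sum_(i < P) (1 + #|[set v | B i v]|))).
  apply: leq_sum => i _; rewrite -(cards1 r).
  apply: leq_trans (leq_card_setU _ _); apply/subset_leq_card/subsetP => v.
  rewrite !inE /layer_color /lcode /B (_ : (m0 + i).-1 = m0.-1 + i); last by lia.
  rewrite -d_root; case: ltnP => [lt|_].
    by case/or4P => [| | /eqP|/andP []]; rewrite ?addn_eq0 ?andbF //; lia.
  move=> H; apply/orP; right.
  by case/or4P: H => [/eqP ->|/eqP ->|/eqP ->|/andP [/eqP -> _]].
rewrite big_split /= sum_nat_const card_ord muln1 leq_add2l.
have E (i : 'I_P) : #|[set v | B i v]| = \sum_(v : node G) B i v.
  by rewrite cardsE -sum1_card big_mkcond.
under eq_bigr => i _ do rewrite E.
rewrite exchange_big /= -[X in 4 * X]sum1_card mulnC big_distrl /= [X in _ <= X]big_mkcond.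
apply: leq_sum => v _; rewrite inE mul1n; case: (leqP m0.-1 (d v)) => H; last first.
  by rewrite big1 // => i _; rewrite /B leqNgt (leq_trans H) // leq_addr.
apply: leq_trans (residues_le (d v - m0.-1)); rewrite -sum1_card [X in _ <= X]big_mkcond /=.
apply: leq_sum => i _; rewrite inE /B -subnDA.
have -> : (i <= d v - m0.-1) = (m0.-1 + i <= d v) by lia.
by case: ifP.
Qed.

Lemma sparse_offset : 4 * m0.-1 >= P -> m0.-1 <= #|[set v | d v < m0.-1]| ->
  exists2 i, i < P & P * #|[pred v | layer_color d (lcode (m0 + i) P) v]| <= 4 * #|node G|.
Proof.
move=> Pm0 near; pose B i := #|[pred v | layer_color d (lcode (m0 + i) P) v]|.
have [/existsP [i Hi]|/existsPn H] := boolP [exists i : 'I_P, P * B i <= 4 * #|node G|].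
  by exists i.
have tot : \sum_(i < P) B i <= 4 * #|node G|.
  apply: leq_trans black_sum _; rewrite -(cardC [set v | m0.-1 <= d v]).
  have -> : #|[predC [set v | m0.-1 <= d v]]| = #|[set v | d v < m0.-1]|.
    by rewrite cardsE; apply: eq_card => v; rewrite !inE -ltnNge.
  lia.
have : \sum_(i < P) (4 * #|node G|).+1 <= \sum_(i < P) P * B i.
  by apply: leq_sum => i _; rewrite ltnNge; apply: H.
rewrite sum_nat_const card_ord -[X in _ <= X]big_distrr leq_pmul2l /=; [|lia].
by rewrite ltnNge tot.
Qed.
End Counting.

(** * Number of states *)

Section Memory.
Local Open Scope nat_scope.
Variable D : nat.
Hypothesis D2 : 2 <= D.
Notation M := D.+1.

Fixpoint modalities (f : form) : nat :=
  match f with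
  | Cst _ | Blk => 0
  | If f g h => modalities f + modalities g + modalities h
  | Dia _ f => (modalities f).+1
  end.

Lemma card_evst_If f g h :
  #|evst D (If f g h)| = #|evst D f| + (#|evst D g| + #|evst D h|).
Proof. by rewrite !card_sum. Qed.

Lemma card_evst_Dia m f : #|evst D (Dia m f)| = M * (3 + M * #|evst D f|).
Proof.
transitivity (#|'I_M| * #|{: option bool + 'I_M * evst D f}|); first exact: card_prod.
by rewrite card_sum card_option card_bool card_prod card_ord.
Qed.

(** Strictness turns sums of sizes into products, by [x + y < x.+1 * y.+1]. *)
Lemma card_evst f : #|evst D f| < M ^ (4 * modalities f).
Proof.
elim: f => [b||f IHf g IHg h IHh|m f IHf].
- by rewrite card_void expn_gt0.
- by rewrite card_void expn_gt0.
- have E x y : M ^ (4 * (x + y)) = M ^ (4 * x) * M ^ (4 * y) by rewrite mulnDr expnD.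
  have S x y : x + y < x.+1 * y.+1 by rewrite mulSn mulnS; lia.
  rewrite card_evst_If /= !E -mulnA; apply: leq_trans (leq_mul IHf (leq_mul IHg IHh)).
  exact: leq_trans (S _ _) (leq_mul (leqnn _) (S _ _)).
- rewrite card_evst_Dia /= mulnS expnD.
  have h : M * (3 + M * #|evst D f|) < M ^ 4 * #|evst D f|.+1.
    have -> : M ^ 4 = M * M * (M * M) by rewrite !expnS expn0 muln1 !mulnA.
    nia.
  by apply: leq_trans h _; rewrite leq_mul2l IHf orbT.
Qed.

Lemma modalities_level j : modalities (level j) = j + 3.
Proof. by elim: j => //= j ->; lia. Qed.

Lemma leq_powM m n : m <= n -> M ^ m <= M ^ n.
Proof. by move=> mn; rewrite leq_pexp2l. Qed.

(** Counting modalities would give an exponent quadratic in [k]; adding the sizes of the branches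
    keeps it linear. *)
Lemma card_find_level k j : 0 < j ->
  #|evst D (find_level k j)| <= 2 * k * M ^ (4 * (j + k + 3)).
Proof.
elim: k j => [|k IH] j j0; first by rewrite card_void.
have h1 := card_evst (level j); rewrite modalities_level in h1.
have h2 := card_evst (Dia true (level j.-1)); rewrite [modalities _]/= modalities_level in h2.
have h3 := IH j.+1 isT.
have g1 : M ^ (4 * (j + 3)) <= M ^ (4 * (j + k.+1 + 3)) by apply: leq_powM; lia.
have g2 : M ^ (4 * (j.-1 + 3).+1) <= M ^ (4 * (j + k.+1 + 3)) by apply: leq_powM; lia.
rewrite addSnnS in h3; move: (leq_trans h1 g1) (leq_trans h2 g2) h3.
change (find_level k.+1 j) with (If (level j) (Dia true (level j.-1)) (find_level k j.+1)).
by set X := M ^ (4 * (j + k.+1 + 3)); rewrite card_evst_If mulnS mulnDl; lia.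
Qed.

Lemma card_isParent J : #|evst D (isParent J)| <= (9 + 2 * J) * M ^ (68 + 4 * (J + 4)).
Proof.
set X := M ^ _.
(* 17 is attained by [Dia true isMid]. *)
have S f : modalities f <= 17 -> #|evst D f| <= X.
  move=> fn; apply: ltnW; apply: leq_trans (card_evst f) _; apply: leq_powM; lia.
have E := card_evst_If.
have F : #|evst D (find_level J 1)| <= 2 * J * X.
  apply: leq_trans (card_find_level J (isT : 0 < 1)) _; rewrite leq_mul2l.
  by apply/orP; right; apply: leq_powM; lia.
do 5!rewrite (E _ (Dia true _)).
have := S isB isT; have := S (Dia true isOff) isT; have := S isTop isT.
have := S (Dia true (Not Blk)) isT; have := S isMid isT.
have := S (Dia true isTop) isT; have := S (Dia true isMid) isT.
have := S isOff isT; have := S (Dia true isTriple) isT.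
have -> : #|evst D Blk| = 0 by rewrite card_void.
by rewrite mulnDl; lia.
Qed.

Lemma card_tour J : #|rstate (tour_robot D (isParent J) isRoot)| <= D ^ (300 + 16 * J).
Proof.
have -> : #|rstate (tour_robot D (isParent J) isRoot)| =
    4 + (2 * M * #|evst D (isParent J)| + #|evst D isRoot|).
  transitivity #|{: option (option bool) +
    (bool * 'I_M * evst D (isParent J) + evst D isRoot)}|; first by [].
  by rewrite card_sum card_option card_option card_bool card_sum 2!card_prod card_bool card_ord.
have hP := card_isParent J.
have hR : #|evst D isRoot| <= M ^ (68 + 4 * (J + 4)).
  apply: ltnW; apply: leq_trans (card_evst isRoot) _; apply: leq_powM.
  by change (modalities isRoot) with 14; lia.
have hM : M ^ (68 + 4 * (J + 4)) <= M ^ (85 + 4 * J) by apply: leq_powM; lia.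
have hM1 : M * M ^ (68 + 4 * (J + 4)) = M ^ (85 + 4 * J).
  by rewrite -expnS; congr (M ^ _); lia.
have h0 : 0 < M ^ (85 + 4 * J) by rewrite expn_gt0.
(* [23 + 4 * J] is [4 + 2 * (9 + 2 * J) + 1]: the plain states, the parent tests and the root
   test. *)
apply: (@leq_trans ((23 + 4 * J) * M ^ (85 + 4 * J))).
  have : 2 * M * #|evst D (isParent J)| <= 2 * (9 + 2 * J) * M ^ (85 + 4 * J).
    by rewrite -hM1; move: hP; set Y := M ^ _; nia.
  by move: hR hM h0; set X := M ^ (85 + _); set Y := M ^ _; lia.
apply: (@leq_trans (M ^ (23 + 4 * J) * M ^ (85 + 4 * J))).
  rewrite leq_mul2r; apply/orP; right; apply: ltnW; apply: ltn_expl; lia.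
rewrite -expnD; apply: (@leq_trans ((D ^ 2) ^ (23 + 4 * J + (85 + 4 * J)))).
  by rewrite leq_exp2r; nia.
by rewrite -expnM leq_pexp2l; lia.
Qed.

End Memory.

(** * Assembly of the bounds *)

Lemma sparse_exploration (G : pgraph) (Delta D P : nat) :
  (2 <= Delta)%N -> gconnected G -> max_deg_le G Delta -> diameter_is G D ->
  (9 <= P <= D + 2)%N ->
  exists (col : node G -> bool) (r : node G) (T : nat),
    [/\ (0 < nblack col)%N, (P * nblack col <= 4 * #|node G|)%N,
        explores_in (tour_robot Delta (isParent (2 * P)) isRoot) col r T &
        (T <= 424 * (#|node G| * Delta ^ (P - 1)) + 848 * Delta ^ (3 * P + 1))%N].
Proof.
move=> D2 Gc degD [_ [r [w far]]] /andP [P9 PD].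
pose d := gdist r Gc; pose m0 := uphalf P.
have m0P : (2 * m0 <= P + 1)%N by rewrite /m0; lia.
have Pm0 : (P <= 2 * m0)%N by rewrite /m0; lia.
have wfar : (D <= d w)%N.
  rewrite leqNgt; apply/negP => lt; apply: (far (d w)) => //.
  by apply: ball_reach; rewrite -(dist_ball r Gc).
have d_root := dist_root r Gc; have d_adj := @dist_adj G r Gc; have d_par := @dist_par G r Gc.
have root_child : exists2 u, adjacent r u & d u = 1%N.
  have [u u1] := @dist_level G r Gc w 1 ltac:(rewrite -/d; lia).
  have [|t ut tu] := d_par u; first by rewrite -d_root u1.
  have /eqP : d t = 0%N by move: tu; rewrite u1 /d; lia.
  by rewrite d_root => /eqP tr; exists u; rewrite // -tr adjacent_sym.
have [i iP sparse] := @sparse_offset G r d d_root m0 P ltac:(lia) P9 ltac:(lia)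
  (@card_dist_lt G r Gc w m0.-1 ltac:(rewrite -/d; lia)).
set m := (m0 + i)%N in sparse; pose code := lcode m P.
have m5 : (5 <= m)%N by lia.
have code0 : code 0%N = 4%N by rewrite /code /lcode; case: ltnP; lia.
have codeS := lcodeS m5 P9.
have top v : (d v <= m.+1)%N -> (depth_code d code v <= m + 3)%N.
  exact: lcode_depth_top.
have deep v : (m <= d v)%N -> (depth_code d code v <= P)%N.
  exact: lcode_depth_deep.
(* The large exponent is charged only inside the ball of radius [m]. *)
pose e v := if (d v <= m)%N then m.+1 else (P - 2)%N.
have [||||T HT leT] := @layers_explore G r d d_root d_adj d_par root_child code code0 codeS
  Delta (2 * P) D2 degD _ e.
- move=> v; case: (leqP (d v) m) => dv; first by have := top v (leqW dv); lia.
  by have := deep v (ltnW dv); lia.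
- by move=> v; rewrite /e; case: ifP; lia.
- move=> v; rewrite /e; case: (leqP (d v) m) => dv; first by have := top v (leqW dv); lia.
  by have := deep v (ltnW dv); lia.
- move=> u v vu; rewrite /e; case: (leqP (d v) m) => dv.
    have := top u (leq_trans (d_adj _ _ vu) _); rewrite ltnS => /(_ dv); lia.
  have du : (m <= d u)%N by rewrite adjacent_sym in vu; have := d_adj _ _ vu; rewrite -/d; lia.
  by have := deep u du; lia.
exists (layer_color d code), r, T; split=> //.
  apply/card_gt0P; exists r; rewrite inE /layer_color.
  by rewrite (_ : d r = 0%N) ?code0 //; apply/eqP; rewrite d_root.
apply: leq_trans leT _.
have nearC : (#|[set v | d v <= m]| <= 2 * Delta ^ m)%N.
  apply: leq_trans (ltnW (card_ball r m D2 degD)).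
  by apply/subset_leq_card/subsetP => v; rewrite inE -(dist_ball r Gc).
have sumE : (\sum_(v : node G) 212 * Delta ^ e v <=
    212 * (2 * Delta ^ m * Delta ^ m.+1) + 212 * (#|node G| * Delta ^ (P - 2)))%N.
  apply: (@leq_trans (\sum_(v : node G) ((if v \in [set v | d v <= m] then 212 * Delta ^ m.+1 else 0)
      + 212 * Delta ^ (P - 2)))%N).
    by apply: leq_sum => v _; rewrite inE /e; case: ifP; lia.
  rewrite big_split /= -big_mkcond !sum_nat_const; apply: leq_add; last first.
    by rewrite mulnCA leqnn.
  by rewrite mulnCA leq_mul2l /= leq_mul2r nearC orbT.
apply: leq_trans (leq_mul (leqnn _) sumE) _.
apply: (@leq_trans (2 * Delta * (212 * (2 * Delta ^ m * Delta ^ m.+1)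
    + 212 * (#|node G| * Delta ^ (P - 2))))%N).
  by rewrite leq_mul2r; apply/orP; right; lia.
(* [m <= m0 + P - 1] and [2 * m0 <= P + 1] give [2 * m + 2 <= 3 * P + 1]. *)
have h1 : (Delta * (Delta ^ m * Delta ^ m.+1) <= Delta ^ (3 * P + 1))%N.
  by rewrite -expnD -expnS leq_pexp2l; lia.
have h2 : (Delta * Delta ^ (P - 2) = Delta ^ (P - 1))%N.
  by rewrite -expnS; congr expn; lia.
rewrite -h2; move: h1; set X := (Delta ^ m)%N; set Y := (Delta ^ m.+1)%N.
set Z := (Delta ^ (P - 2))%N; set W := (Delta ^ (3 * P + 1))%N.
by rewrite mulnDr; nia.
Qed.

Theorem theorem3 :
  exists c1 c2 : R,
  forall (Delta : nat) (rho : Q),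
    (2 <= Delta)%N -> 2 < Q2R rho ->
    exists Rb : robot,
      mem_bits Rb <= c1 * Q2R rho * log2 (INR Delta) /\
      forall (G : pgraph) (D : nat),
        gconnected G -> max_deg_le G Delta -> diameter_is G D ->
        Q2R rho <= (INR D + 1) / 4 ->
        exists (col : node G -> bool) (r : node G) (T : nat),
          [/\ N_ratio_ge col (Q2R rho),
              explores_in Rb col r T &
              INR T <= c2 * (INR #|node G|
                               * Rpower (INR Delta) ((16 * Q2R rho + 7) / 3)
                               / Q2R rho
                             + Rpower (INR Delta) ((40 * Q2R rho + 10) / 3))].
Proof.
exists 294, 848 => Delta rhoQ D2 rho2; set rho := Q2R rhoQ in rho2 *.
(* The least integer above [4 * rho]: the hypotheses on [rho] become [9 <= P <= D + 2]. *)
have [P [P1 P2]] : exists P : nat, 4 * rho < INR P /\ INR P <= 4 * rho + 1.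
  have [h1 h2] := archimed (4 * rho); exists (Z.to_nat (up (4 * rho))).
  have pos : (0 <= up (4 * rho))%Z by apply: le_IZR; lra.
  rewrite INR_IZR_INZ Z2Nat.id //; lra.
have P9 : (9 <= P)%N.
  apply/ssrnat.leP/INR_lt; rewrite !S_INR /=; lra.
have Dpos : 2 <= INR Delta by have /ssrnat.leP/le_INR := D2; rewrite /=; lra.
have ln2 : / 2 < ln 2 := ln_lt_2.
have lnD : ln 2 <= ln (INR Delta).
  by have [lt|<-] := Dpos; [apply/Rlt_le/ln_increasing; lra | lra].
have pow k x : INR k <= x -> INR (Delta ^ k)%N <= Rpower (INR Delta) x.
  move=> kx; have -> : INR (Delta ^ k)%N = Rpower (INR Delta) (INR k).
    rewrite Rpower_pow; last lra.
    elim: k {kx} => [|k IH]; first by [].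
    by rewrite expnS mult_INR IH.
  by apply: Rle_Rpower; lra.
exists (tour_robot Delta (isParent (2 * P)) isRoot); split.
  rewrite /mem_bits /log2 /Rdiv -Rmult_assoc.
  apply: Rmult_le_compat_r; first by apply/Rlt_le/Rinv_0_lt_compat; lra.
  have /ssrnat.leP/le_INR h := card_tour D2 (2 * P).
  set c := #|_| in h *.
  have c0 : 0 < INR c.
    by apply/lt_0_INR/ssrnat.ltP; apply/card_gt0P; exists (Init _ _ _).
  (* [300 + 32 * (4 * rho + 1) <= 294 * rho] amounts to [2 <= rho]. *)
  have E : INR (300 + 16 * (2 * P))%N <= 294 * rho.
    by rewrite plus_INR !mult_INR !INR_IZR_INZ /= -INR_IZR_INZ; lra.
  have {}h := Rle_trans _ _ _ h (pow _ _ E).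
  rewrite -(ln_exp (294 * rho * ln (INR Delta))).
  by case: h => [lt|->]; [apply/Rlt_le/ln_increasing | apply: Rle_refl].
move=> G D Gc degD diamD rhoD.
have PD : (9 <= P <= D + 2)%N.
  rewrite P9; apply/ssrnat.leP/INR_le; rewrite plus_INR /=; lra.
have [col [r [T [b0 b1 HT]]]] := sparse_exploration D2 Gc degD diamD PD.
move=> /ssrnat.leP/le_INR leT; exists col, r, T; split=> //.
  split=> //; have bpos : 0 < INR (nblack col) by apply/lt_0_INR/ssrnat.ltP.
  move/ssrnat.leP/le_INR: b1; rewrite !mult_INR [INR 4]/= => b1.
  apply: (Rmult_le_reg_r (INR (nblack col))) => //.
  rewrite /Rdiv Rmult_assoc Rinv_l; nra.
apply: Rle_trans leT _; set n := #|node G|; set X := Rpower _ _; set Y := Rpower _ _.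
have hY : INR (Delta ^ (3 * P + 1))%N <= Y.
  by apply: pow; rewrite plus_INR mult_INR /=; lra.
(* The division by [rho] is paid for by the exponent: [rho] is at most twice the power [rho] of
   [Delta], and [5 * rho <= (16 * rho + 7) / 3]. *)
have hX : INR (Delta ^ (P - 1))%N * rho <= 2 * X.
  have h4 : INR (Delta ^ (P - 1))%N <= Rpower (INR Delta) (4 * rho).
    apply: pow; rewrite minus_INR /=; first lra.
    by apply/ssrnat.leP; lia.
  have h1 : rho <= 2 * Rpower (INR Delta) rho.
    have := exp_ineq1_le (rho * ln (INR Delta)); rewrite -/(Rpower _ _); nra.
  have h5 : Rpower (INR Delta) (4 * rho) * Rpower (INR Delta) rho <= X.
    by rewrite -Rpower_plus; apply: Rle_Rpower; lra.
  have := pos_INR (Delta ^ (P - 1)); nra.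
have n0 := pos_INR n.
have hX' : INR n * INR (Delta ^ (P - 1))%N <= 2 * (INR n * X / rho).
  apply: (Rmult_le_reg_r rho); first lra.
  have -> : 2 * (INR n * X / rho) * rho = INR n * (2 * X) by field; lra.
  by rewrite Rmult_assoc; apply: Rmult_le_compat_l.
rewrite plus_INR !mult_INR (_ : INR 424 = 424); last by rewrite INR_IZR_INZ.
rewrite (_ : INR 848 = 848); last by rewrite INR_IZR_INZ.
lra.
Qed.
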